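(* Let $n\ge 2$ and let $R=(r_{ij})=\begin{pmatrix} R_{11} & r\\ r^t & 1\end{pmatrix}$ be a non-singular $(n\times n)$-correlation matrix, where $R_{11}$ is the upper left $((n-1)\times(n-1))$-block and $r\in\mathbb{R}^{n-1}$ satisfies $r\neq 0$. Assume that the Laplace transform $|I_n+RT|^{-1}$ is infinitely divisible. (i) For every $\tau\in[0,1]$ put $R_\tau=\begin{pmatrix} R_{11} & \tau r\\ \tau r^t & 1\end{pmatrix}$. Then for all $\tau\in[0,1]$ the Laplace transform $|I_n+R_\tau T|^{-1}$ is infinitely divisible, and for all positive numbers $\alpha,x_1,\dots,x_n$ the value $G_\alpha(x_1,\dots,x_n;R_\tau)$ of the cumulative distribution function of the $\Gamma_n(\alpha,R_\tau)$-distribution is an increasing function of $\tau\in[0,1]$. This implies, for all positive numbers $\alpha,x_1,\dots,x_n$, $$G_\alpha(x_1,\dots,x_n;R)>G_\alpha(x_1,\dots,x_{n-1};R_{11})\,G_\alpha(x_n)\ \ge\ \prod_{j=1}^n G_\alpha(x_j).$$ (ii) For $\tau=(\tau_1,\dots,\tau_n)\in[0,1]^n$ put $R_\tau=\mathrm{diag}(1-\tau_1^2,\dots,1-\tau_n^2)+(\tau_i r_{ij}\tau_j)_{i,j=1,\dots,n}$. Then, for all positive numbers $\alpha,x_1,\dots,x_n$, $G_\alpha(x_1,\dots,x_n;R_\tau)$ is a non-decreasing function of each $\tau_i$, $i=1,\dots,n$.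
   Context: A correlation matrix is a real symmetric positive semi-definite matrix with all diagonal entries equal to $1$. $|A|$ denotes the determinant of a square matrix $A$, $A^t$ the transpose, $I_n$ the identity matrix, and $T=\mathrm{diag}(t_1,\dots,t_n)$ with $t_1,\dots,t_n\ge 0$. For $\alpha,x>0$, $G_\alpha(x)=\int_0^x \Gamma(\alpha)^{-1}e^{-y}y^{\alpha-1}\,dy$ is the cumulative distribution function (cdf) of the univariate gamma distribution with shape parameter $\alpha$. For a non-singular $(n\times n)$-correlation matrix $R$ and $\alpha>0$, if the function $(t_1,\dots,t_n)\mapsto|I_n+RT|^{-\alpha}$ on $[0,\infty)^n$ is the Laplace transform $E\big(e^{-\sum_j t_jY_j}\big)$ of the distribution of a random vector $(Y_1,\dots,Y_n)$ with values in $[0,\infty)^n$, this distribution is called the $\Gamma_n(\alpha,R)$-distribution, and $G_\alpha(x_1,\dots,x_n;R)=P(Y_1\le x_1,\dots,Y_n\le x_n)$ denotes its cdf. The Laplace transform $|I_n+RT|^{-1}$ is called infinitely divisible if for every $\alpha>0$ the function $|I_n+RT|^{-\alpha}$ is the Laplace transform of a probability distribution on $[0,\infty)^n$; then the $\Gamma_n(\alpha,R)$-distribution exists for every $\alpha>0$. ''Increasing'' means strictly increasing, as opposed to ''non-decreasing''. *)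

(* Defs.v *)
From HB Require Import structures.
From mathcomp Require Import all_boot all_order all_algebra.
From mathcomp Require Import all_classical all_reals all_analysis.
Set Implicit Arguments.
Unset Strict Implicit.
Unset Printing Implicit Defensive.
Import Order.TTheory GRing.Theory Num.Theory.
Import numFieldNormedType.Exports.
Local Open Scope classical_set_scope.
Local Open Scope ring_scope.

Definition positive_semidefinite (K : realType) (n : nat) (A : 'M[K]_n) : Prop :=
  forall u : 'cV[K]_n, 0 <= (u^T *m A *m u) 0 0.

Definition correlation_matrix (K : realType) (n : nat) (A : 'M[K]_n) : Prop :=
  [/\ A^T = A, positive_semidefinite A & forall i, A i i = 1].

Definition nonsingular_correlation_matrix (K : realType) (n : nat)
    (A : 'M[K]_n) : Prop :=
  correlation_matrix A /\ A \in unitmx.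

Definition GammaFun (K : realType) (alpha : K) : K :=
  \int[lebesgue_measure]_(y in `[0, +oo[) (expR (- y) * y `^ (alpha - 1)).

Definition gamma_cdf (K : realType) (alpha x : K) : K :=
  \int[lebesgue_measure]_(y in `[0, x])
    ((GammaFun alpha)^-1 * expR (- y) * y `^ (alpha - 1)).

(* A law on [0, oo)^n is a probability measure on R^n, represented by
   n.-tuple K with the product sigma-algebra, carried by the orthant;
   [phi] is only constrained at t with nonnegative entries. *)
Definition is_laplace_transform (K : realType) (n : nat)
    (mu : probability (n.-tuple K) K) (phi : 'rV[K]_n -> K) : Prop :=
  mu [set y | forall j, 0 <= tnth y j] = 1%E /\
  forall t : 'rV[K]_n, (forall j, 0 <= t 0 j) ->
    (\int[mu]_y (expR (- \sum_j t 0 j * tnth y j))%:E)%E = (phi t)%:E.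

(* The function t |-> |I_n + R T|^(- alpha). *)
Definition gamma_lt (K : realType) (n : nat) (alpha : K) (R : 'M[K]_n)
    (t : 'rV[K]_n) : K :=
  (\det (1%:M + R *m diag_mx t)) `^ (- alpha).

Definition infinitely_divisible (K : realType) (n : nat) (R : 'M[K]_n) : Prop :=
  forall alpha : K, 0 < alpha ->
    exists mu : probability (n.-tuple K) K,
      is_laplace_transform mu (gamma_lt alpha R).

Definition is_gamma_distribution (K : realType) (n : nat) (alpha : K)
    (R : 'M[K]_n) (mu : probability (n.-tuple K) K) : Prop :=
  [/\ 0 < alpha, nonsingular_correlation_matrix R &
      is_laplace_transform mu (gamma_lt alpha R)].

(* A law on [0, oo)^n is determined by its Laplace transform, so the set below
   has at most one element; the value is 0 if the Gamma_n(alpha, R)-distribution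
   does not exist. *)
Definition mgamma_cdf (K : realType) (n : nat) (alpha : K) (R : 'M[K]_n)
    (x : 'rV[K]_n) : K :=
  xget 0 [set p | exists2 mu : probability (n.-tuple K) K,
    is_gamma_distribution alpha R mu &
    p%:E = mu [set y | forall j, tnth y j <= x 0 j]].

(* diag(1 - tau_i^2) + (tau_i r_ij tau_j) *)
Definition damped_mx (K : realType) (n : nat) (R : 'M[K]_n) (tau : 'rV[K]_n) :
    'M[K]_n :=
  diag_mx (\row_i (1 - tau 0 i ^+ 2)) +
  \matrix_(i, j) (tau 0 i * R i j * tau 0 j).

(* Main.v *)
Require Import Defs.
From HB Require Import structures.
From mathcomp Require Import all_boot all_order all_fingroup all_algebra.
From mathcomp Require Import all_classical all_reals all_analysis.
From mathcomp Require Import measurable_realfun giry ring lra.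
Set Implicit Arguments.
Unset Strict Implicit.
Unset Printing Implicit Defensive.
Import Order.TTheory GRing.Theory Num.Theory.
Import numFieldNormedType.Exports.
Local Open Scope classical_set_scope.
Local Open Scope ring_scope.

(** With [u_j = exp (- Y_j)], everything is read off from the values
    [D k ^ (- alpha)] of the Laplace transform at integer points [k], where
    [D k = |I + R diag(k)|]: they are the moments of the [u_j], so integrating a
    product of polynomials [q_j(u_j)] against the law is a finite linear
    functional of them, and polynomials converging to the indicator of
    [u_j >= exp (- x_j)] recover the distribution function.  In particular
    [D ^ (- alpha)] is positive on polynomials that are nonnegative on the cube.

    Damping the [i]-th coordinate replaces [Y_i] by [1 - tau^2] times a
    noncentral gamma variable whose parameter is proportional to [Y_i], which
    gives existence.  The determinant of the damped matrix is multiaffine in [k]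
    and affine in [theta = tau_i^2], say [e - theta b] coefficientwise.
    Differentiating in [theta] turns [D ^ (- alpha)] into
    [alpha * \sum_S b_S * \prod_(j in S) k_j * D ^ (- alpha - 1)], and the factor
    [k_j] acts on a test polynomial as [u_j d/du_j], which keeps decreasing test
    functions of [Y_j] nonnegative.  So monotonicity follows from [b_S >= 0]; this
    holds because infinite divisibility makes [- ln D] conditionally positive,
    whence [D k <= (1 + k_i) D (k with k_i := 0)].  For strictness, some [b_J] is
    positive, and conditional positivity bounds [D ^ (- beta)] from below by a
    product of one-dimensional gamma transforms, whose test integrals stay away
    from [0]. *)

(** * Gamma laws *)

(** Integer points suffice because the [u_j] lie in [0, 1] almost surely, where suitable polynomials
    stay bounded and approximate indicators. Neither densities nor uniqueness of Laplace transforms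
    has to be discussed: for any law with the given values, the distribution function is the limit
    of the same test integrals. Stating positivity for abstract functionals [u^k |-> f k] makes it
    stable under sums, products and limits, so powers, logarithms and exponentials of the
    determinant can be handled without exhibiting a Levy measure. The obstacle is strictness, since
    a strict inequality between test integrals becomes weak in the limit. It is met by a lower bound
    on the derivative in [theta] that holds for all large test degrees and all [theta] in [0, 1] at
    once. The exponent [alpha + 1] helps there: a gamma density of shape at least 1 has a
    nondecreasing power factor. All matrices along the path are again nonsingular and infinitely
    divisible, so every estimate is available at each [theta]. *)

Section integral_density.
Import HBNNSimple.

(** Finite additivity gives the identity for simple functions; monotone convergence on both sides
    extends it to [h]. *)
Lemma ge0_integral_density d (T : measurableType d) (K : realType)
    (mu nu : {measure set T -> \bar K}) (f : T -> K) :
  (forall x, 0 <= f x) -> measurable_fun [set: T] f ->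
  (forall A, measurable A -> nu A = \int[mu]_(x in A) (f x)%:E)%E ->
  forall h : T -> \bar K, measurable_fun [set: T] h ->
    (forall x, 0 <= h x)%E ->
  (\int[nu]_x h x = \int[mu]_x (h x * (f x)%:E))%E.
Proof.
move=> f0 /measurable_EFinP mf nuE h mh h0.
have f0E x : (0 <= (f x)%:E)%E by rewrite lee_fin.
pose g := nnsfun_approx measurableT mh.
have mg n : measurable_fun [set: T] (EFin \o g n) by exact/measurable_EFinP.
have g0 n x : (0 <= (g n x)%:E)%E by rewrite lee_fin.
have ndg x : {homo (fun n => (g n x)%:E) : m n / (m <= n)%N >-> (m <= n)%E}.
  move=> m n mn; rewrite lee_fin.
  by have /lefP := nd_nnsfun_approx measurableT mh mn; exact.
have gh x : (g n x)%:E @[n --> \oo] --> h x.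
  by apply: (cvg_nnsfun_approx measurableT mh).
have gfE n : (\int[nu]_x (g n x)%:E = \int[mu]_x ((g n x)%:E * (f x)%:E))%E.
  rewrite integralT_nnsfun sintegralE.
  transitivity (\int[mu]_x (\sum_(r \in range (g n))
      (r * \1_(g n @^-1` [set r]) x)%:E * (f x)%:E))%E; last first.
    apply: eq_integral => x _.
    rewrite [in RHS](@fimfunE _ _ (g n)) -fsumEFin// ge0_mule_fsuml// => r.
    exact: nnfun_muleindic_ge0.
  rewrite ge0_integral_fsum//.
  - apply: eq_fsbigr => r; rewrite inE => -[x _ <-{r}].
    rewrite nuE// integral_mkcond.
    rewrite -ge0_integralZl//.
    + apply: eq_integral => y _; rewrite EFinM -muleA; congr (_ * _)%E.
      rewrite patchE indicE; case: ifPn => _; first by rewrite mul1e.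
      by rewrite mul0e.
    + by apply/(measurable_restrictT _ _).1 => //; exact: measurable_funTS.
    + by move=> y _; rewrite patchE; case: ifP.
  - move=> r; apply: emeasurable_funM => //.
    by apply/measurable_EFinP; apply: measurable_funM => //.
  - by move=> r x _; apply: mule_ge0 => //; exact: nnfun_muleindic_ge0.
have L : (\int[nu]_x (g n x)%:E)%E @[n --> \oo] --> (\int[nu]_x h x)%E.
  rewrite (_ : (\int[nu]_x h x)%E = (\int[nu]_x limn (fun n => (g n x)%:E))%E).
    exact: cvg_monotone_convergence.
  by apply: eq_integral => x _; apply/esym/cvg_lim => //; exact: gh.
have M : (\int[mu]_x ((g n x)%:E * (f x)%:E))%E @[n --> \oo] -->
    (\int[mu]_x (h x * (f x)%:E))%E.
  rewrite (_ : (\int[mu]_x (h x * (f x)%:E))%E =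
      (\int[mu]_x limn (fun n => (g n x)%:E * (f x)%:E))%E); last first.
    apply: eq_integral => x _; apply/esym/cvg_lim => //.
    by apply: cvgeZr => //; exact: gh.
  apply: cvg_monotone_convergence => //.
  - by move=> n; apply: emeasurable_funM => //; exact: mg.
  - by move=> n x _; exact: mule_ge0.
  - by move=> x _ m n mn; rewrite lee_wpmul2r//; exact: ndg.
move: L; under eq_fun do rewrite gfE.
by move=> L; exact: (cvg_unique _ L M).
Qed.

End integral_density.

(** Lebesgue measure equals [c] times its image under multiplication by [c], because the two agree
    on intervals. *)
Lemma ge0_integral_scale (K : realType) (c : K) (f : K -> \bar K) : 0 < c ->
  measurable_fun [set: K] f -> (forall x, 0 <= f x)%E ->
  (\int[lebesgue_measure]_x f x =
   c%:E * \int[lebesgue_measure]_x f (c * x)%R)%E.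
Proof.
move=> c0 mf f0.
have mM : measurable_fun [set: K] ( *%R c) by exact: measurable_funM.
pose nu0 : {measure set _ -> \bar K} := mscale (NngNum (ltW c0))
  (pushforward (@lebesgue_measure K) ( *%R c : _ -> measurableTypeR K)).
pose nu := nu0 mM.
have nuE (A : set K) : measurable A -> lebesgue_measure A = nu A.
  move=> mA; apply: lebesgue_measure_unique => //= _ [[a b]] _ <-.
  rewrite /mscale/= /pushforward.
  rewrite (_ : _ @^-1` _ = `]a / c, b / c]%classic); last first.
    by apply/seteqP; split => x /=; rewrite !in_itv/= ltr_pdivrMr// ler_pdivlMr// ![_ * c]mulrC.
  rewrite !lebesgue_measure_itv/= !lte_fin ltr_pM2r ?invr_gt0//.
  case: ifP => _; last by rewrite mule0.
  by rewrite -EFinM mulrBr ![c * (_ / c)]mulrC !divfK ?gt_eqF.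
rewrite (eq_measure_integral nu); last by move=> A mA _; exact: nuE.
rewrite ge0_integral_mscale//= ge0_integral_pushforward//.
Qed.

Lemma integral_is_derive (K : realType) (F f : K -> K) (a b : K) : a < b ->
  (forall x, a <= x <= b -> is_derive x 1 F (f x)) ->
  (forall x, a <= x <= b -> {for x, continuous f}) ->
  (\int[lebesgue_measure]_(x in `[a, b]) (f x)%:E = (F b - F a)%:E)%E.
Proof.
move=> ab dF cf.
have cF x : a <= x <= b -> F z @[z --> x] --> F x.
  move=> /dF dFx; apply: differentiable_continuous.
  by apply/derivable1_diffP; exact: ex_derive.
rewrite EFinB (@continuous_FTC2 _ f F)//.
- by apply: continuous_in_subspaceT => x; rewrite inE/= in_itv/= => /cf.
- split.
  + by move=> x; rewrite in_itv/= => /andP[/ltW ax /ltW xb];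
    apply: ex_derive; apply: dF; rewrite ax.
  + by apply: cvg_at_right_filter; apply: cF; rewrite lexx ltW.
  + by apply: cvg_at_left_filter; apply: cF; rewrite lexx ltW.
- move=> x; rewrite in_itv/= => /andP[/ltW ax /ltW xb].
  by rewrite derive1E; apply: derive_val; apply: dF; rewrite ax.
Qed.

Definition gamma_ker (K : realType) (a y : K) : K := expR (- y) * y `^ (a - 1).

Section gamma_ker.
Context {K : realType}.
Implicit Types a c x y : K.
Local Notation leb := (@lebesgue_measure K).

Lemma gamma_ker_ge0 a y : 0 <= gamma_ker a y.
Proof. by rewrite mulr_ge0// ?expR_ge0 ?powR_ge0. Qed.

Lemma measurable_gamma_ker a D : measurable_fun D (gamma_ker a).
Proof.
apply: measurable_funTS; apply: measurable_funM; last exact: measurable_powR.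
by apply: measurableT_comp => //; exact: measurable_expR.
Qed.

Lemma integral_gamma_ker_01_fin a : 0 < a ->
  (\int[leb]_(y in `]0%R, 1%R]) (gamma_ker a y)%:E < +oo)%E.
Proof.
move=> a0.
pose F (i : nat) : set K := `[i.+1%:R^-1, 1]%classic.
have mF i : measurable (F i) by rewrite /F.
have ndF : nondecreasing_seq F.
  move=> i j ij; apply/subsetPset => y; rewrite /F /= !in_itv/= => /andP[iy ->].
  by rewrite (le_trans _ iy)// lef_pV2 ?posrE// ler_nat.
have UF : \bigcup_i F i = `]0, 1]%classic.
  apply/seteqP; split=> [y [i _]|y]; rewrite /F /=.
    by rewrite !in_itv/= => /andP[iy ->]; rewrite andbT (lt_le_trans _ iy) ?invr_gt0.
  rewrite in_itv/= => /andP[y0 y1]; exists (Num.truncn y^-1) => //; rewrite /F /=.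
  rewrite in_itv/= y1 andbT invf_ple ?posrE//.
  by rewrite ltW// truncnS_gt// invr_ge0 ltW.
have cF : (\int[leb]_(y in F i) (y `^ (a - 1))%:E)%E @[i --> \oo] -->
    (\int[leb]_(y in \bigcup_i F i) (y `^ (a - 1))%:E)%E.
  apply: ge0_nondecreasing_set_cvg_integral => // [i|i y _].
    by apply/measurable_funTS/measurable_EFinP; exact: measurable_powR.
  by rewrite lee_fin powR_ge0.
have : (\int[leb]_(y in \bigcup_i F i) (y `^ (a - 1))%:E <= a^-1%:E)%E.
  rewrite -(cvg_lim _ cF)//; apply: lime_le; first by apply/cvg_ex; eexists; exact: cF.
  apply: nearW => i; rewrite /F.
  (* The first interval is the point 1, to which the fundamental theorem for [a < b] does not
     apply. *)
  have [->|i0] := eqVneq i 0%N.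
    by rewrite invr1 set_itv1 integral_set1// lee_fin invr_ge0 ltW.
  have i1 : i.+1%:R^-1 < 1 :> K by rewrite invf_lt1 ?ltr1n ?ltnS ?lt0n.
  have ip : 0 < i.+1%:R^-1 :> K by rewrite invr_gt0.
  have dF y : 0 < y -> is_derive y 1 (fun y => a^-1 * y `^ a) (y `^ (a - 1)).
    move=> y0; have dy := is_derive1_powR a y0.
    apply: (is_derive_eq (is_deriveZ _ _)).
    by rewrite -[_ *: _]/(_ * _) mulrA mulVf ?gt_eqF// mul1r.
  have -> : (\int[leb]_(y in `[(i.+1%:R^-1)%R, 1%R]) (y `^ (a - 1))%:E =
      (a^-1 * 1 `^ a - a^-1 * i.+1%:R^-1 `^ a)%R%:E)%E.
    apply: (@integral_is_derive _ (fun y => a^-1 * y `^ a)) => // y /andP[iy _].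
      exact/dF/(lt_le_trans ip iy).
    apply: differentiable_continuous; apply/derivable1_diffP.
    by apply: derivable_powR; rewrite in_itv/= (lt_le_trans ip iy).
  rewrite lee_fin powR1 mulr1 gerBl.
  by rewrite mulr_ge0 ?powR_ge0// invr_ge0 ltW.
rewrite UF; move=> le_a; apply: le_lt_trans (ltry a^-1).
apply: le_trans le_a; apply: ge0_le_integral => //.
- by move=> y _; rewrite lee_fin gamma_ker_ge0.
- by apply/measurable_EFinP; exact: measurable_gamma_ker.
- by apply/measurable_funTS/measurable_EFinP; exact: measurable_powR.
- move=> y; rewrite /= in_itv/= => /andP[y0 _]; rewrite lee_fin.
  by rewrite ler_piMl ?powR_ge0// -expR0 ler_expR oppr_le0 ltW.
Qed.

Lemma integral_gamma_ker_1y_fin a :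
  (\int[leb]_(y in `]1%R, +oo[) (gamma_ker a y)%:E < +oo)%E.
Proof.
(* Since [n.+1] exceeds [a - 1] and [expR (y / 2)] is at least its Taylor term of order [n.+1], the
   kernel is at most [C * expR (- y / 2)] for [y > 1]; this is [2 * C] times the exponential density
   of rate 1/2. *)
pose n := Num.truncn `|a - 1|.
pose C : K := n.+1`!%:R * 2 ^+ n.+1.
have C0 : 0 <= C by rewrite mulr_ge0 ?exprn_ge0.
have le_pdf y : 1 < y -> gamma_ker a y <= 2 * C * exponential_pdf 2^-1 y.
  move=> y1; have y0 : 0 < y := lt_trans ltr01 y1.
  rewrite exponential_pdfE ?(ltW y0)// (mulrC 2) -(mulrA C) (mulrA 2) divff// mul1r.
  have -> : C * expR (- 2^-1 * y) = expR (- y) * (C * expR (2^-1 * y)).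
    rewrite mulrCA -expRD; congr (_ * expR _); lra.
  rewrite ler_wpM2l ?expR_ge0//.
  apply: (@le_trans _ _ (y ^+ n.+1)).
    rewrite -powR_mulrn ?(ltW y0)// ler_powR ?(ltW y1)//.
    by rewrite (le_trans (ler_norm _))// ltW// truncnS_gt.
  have := @expR_ge1Dxn _ (2^-1 * y) n; rewrite mulr_ge0 ?(ltW y0)// => /(_ isT) h.
  have : (2^-1 * y) ^+ n.+1 / n.+1`!%:R <= expR (2^-1 * y).
    by rewrite (le_trans _ h)// lerDr.
  rewrite ler_pdivrMr ?ltr0n ?fact_gt0// exprMn exprVn mulrC ler_pdivrMr ?exprn_gt0//.
  by move=> h2; apply: (le_trans h2); rewrite le_eqVlt; apply/orP; left;
    apply/eqP; rewrite /C; ring.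
apply: (@le_lt_trans _ _ (\int[leb]_y ((2 * C)%:E * (exponential_pdf 2^-1 y)%:E))%E).
  rewrite integral_mkcond; apply: ge0_le_integral => //.
  - by move=> y _; rewrite patchE; case: ifP => // _; rewrite lee_fin gamma_ker_ge0.
  - apply/(measurable_restrictT _ _).1 => //.
    by apply/measurable_EFinP; exact: measurable_gamma_ker.
  - apply/measurable_EFinP; apply: measurable_funM => //.
    exact: measurable_exponential_pdf.
  - move=> y _; rewrite patchE; case: ifPn => [|_].
      by rewrite inE/= in_itv/= andbT => /le_pdf; rewrite lee_fin.
    by rewrite lee_fin !mulr_ge0// exponential_pdf_ge0// invr_ge0.
rewrite ge0_integralZl//=.
- by rewrite integral_exponential_pdf// mule1 ltry.
- by apply/measurable_EFinP; exact: measurable_exponential_pdf.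
- by move=> y _; rewrite lee_fin exponential_pdf_ge0// invr_ge0.
- by rewrite lee_fin mulr_ge0.
Qed.

Lemma integral_gamma_ker_fin a : 0 < a ->
  (\int[leb]_(y in `[0%R, +oo[) (gamma_ker a y)%:E < +oo)%E.
Proof.
move=> a0.
have mg D : measurable_fun D (fun y => (gamma_ker a y)%:E).
  by apply/measurable_EFinP; exact: measurable_gamma_ker.
rewrite -integral_itv_obnd_cbnd//.
rewrite (@itv_bndbnd_setU _ _ _ (BRight 1))//; last by rewrite bnd_simp.
rewrite ge0_integral_setU//=.
- apply: lte_add_pinfty; [exact: integral_gamma_ker_01_fin|exact: integral_gamma_ker_1y_fin].
- exact: mg.
- by move=> y _; rewrite lee_fin gamma_ker_ge0.
- by apply/disj_setPS => y /= []; rewrite !in_itv/= => /andP[_ y1]; rewrite andbT ltNge y1.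
Qed.

Lemma EFin_GammaFun a : 0 < a ->
  (GammaFun a)%:E = (\int[leb]_(y in `[0%R, +oo[) (gamma_ker a y)%:E)%E.
Proof.
move=> a0; rewrite /GammaFun/Rintegral fineK// ge0_fin_numE.
  exact: integral_gamma_ker_fin.
by apply: integral_ge0 => y _; rewrite lee_fin gamma_ker_ge0.
Qed.

Lemma GammaFun_gt0 a : 0 < a -> 0 < GammaFun a.
Proof.
move=> a0; rewrite -lte_fin EFin_GammaFun//.
(* A lower bound for the kernel on [1, 2], where [ln y] lies between 0 and 2. *)
pose c : K := expR (- 2) * expR (- (`|a - 1| * 2)).
have c0 : 0 < c by rewrite mulr_gt0 ?expR_gt0.
apply: (@lt_le_trans _ _ (\int[leb]_(y in `[1%R, 2%R]) c%:E)%E).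
  rewrite integral_cst//= lebesgue_measure_itv/= lte_fin ltr1n -EFinB -EFinM lte_fin.
  by rewrite mulr_gt0//; lra.
have sub : [set` `[1 : K, 2%R]] `<=` [set` `[0 : K, +oo[].
  by move=> y /=; rewrite !in_itv/= andbT => /andP[y1 _]; rewrite (le_trans _ y1).
have mg D : measurable_fun D (fun y => (gamma_ker a y)%:E).
  by apply/measurable_EFinP; exact: measurable_gamma_ker.
apply: (@le_trans _ _ (\int[leb]_(y in `[1%R, 2%R]) (gamma_ker a y)%:E)%E); last first.
  apply: ge0_subset_integral => //; first exact: mg.
  by move=> y _; rewrite lee_fin gamma_ker_ge0.
apply: ge0_le_integral => //; first by move=> y _; rewrite lee_fin ltW.
  exact: mg.
move=> y; rewrite /= in_itv/= => /andP[y1 y2]; rewrite lee_fin.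
have y0 := lt_le_trans ltr01 y1.
rewrite ler_pM ?expR_ge0// ?ler_expR ?lerN2// /powR gt_eqF// ler_expR.
have : `|(a - 1) * ln y| <= `|a - 1| * 2.
  rewrite normrM ler_wpM2l// ger0_norm ?ln_ge0//.
  by rewrite (le_trans _ y2)// ltW// ln_sublinear.
by rewrite ler_norml => /andP[].
Qed.

End gamma_ker.

Section gamma_law.
Context {K : realType}.
Implicit Types a c t x y : K.
Local Notation leb := (@lebesgue_measure K).

Lemma integral_gamma_ker_scale a c : 0 < a -> 0 < c ->
  (\int[leb]_(y in `[0%R, +oo[) (expR (- (c * y)) * y `^ (a - 1))%:E =
   (c `^ (- a) * GammaFun a)%:E)%E.
Proof.
move=> a0 c0; have ca0 : 0 < c `^ a by rewrite powR_gt0.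
have mg D : measurable_fun D (fun y => (expR (- (c * y)) * y `^ (a - 1))%:E).
  apply/measurable_EFinP; apply: measurable_funTS; apply: measurable_funM.
    apply: measurableT_comp; first exact: measurable_expR.
    by apply: measurableT_comp => //; exact: measurable_funM.
  exact: measurable_powR.
pose f := (fun y => (gamma_ker a y)%:E) \_ `[0%R, +oo[.
have mf : measurable_fun [set: K] f.
  apply/(measurable_restrictT _ _).1 => //.
  by apply/measurable_EFinP; exact: measurable_gamma_ker.
have f0 x : (0 <= f x)%E.
  by rewrite /f patchE; case: ifP => // _; rewrite lee_fin gamma_ker_ge0.
have E := ge0_integral_scale c0 mf f0.
rewrite EFinM EFin_GammaFun// [in RHS]integral_mkcond E.
rewrite [X in (_ * (_ * X))%E](_ : _ = \int[leb]_x ((c `^ (a - 1))%:E *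
    ((fun y => (expR (- (c * y)) * y `^ (a - 1))%:E) \_ `[0%R, +oo[) x))%E; last first.
  apply: eq_integral => x _; rewrite /f !patchE.
  have -> : (c * x \in `[0%R, +oo[%classic) = (x \in `[0%R, +oo[%classic).
    by rewrite !mem_setE !in_itv/= !andbT pmulr_rge0.
  case: ifPn => [|_]; last by rewrite mule0.
  rewrite inE/= in_itv/= andbT => x0; rewrite -EFinM /gamma_ker powRM ?(ltW c0)//.
  by congr (_%:E); ring.
rewrite ge0_integralZl//; last 3 first.
- by apply/(measurable_restrictT _ _).1 => //; exact: mg.
- move=> x _; rewrite patchE; case: ifP => // _.
  by rewrite lee_fin mulr_ge0 ?expR_ge0 ?powR_ge0.
- by rewrite lee_fin powR_ge0.
have cE : c `^ (- a) * (c * c `^ (a - 1)) = 1.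
  by rewrite mulr_powRB1 ?(ltW c0)// powRN mulVf ?gt_eqF.
rewrite 2!muleA -!EFinM -mulrA cE mul1e.
by rewrite [in LHS]integral_mkcond.
Qed.

Definition gamma_pdf a : K -> K :=
  (fun y => (GammaFun a)^-1 * gamma_ker a y) \_ `[0, +oo[.

Lemma GammaFun_ge0 a : 0 <= GammaFun a.
Proof.
by apply: Rintegral_ge0 => y _; rewrite mulr_ge0 ?expR_ge0 ?powR_ge0.
Qed.

Lemma gamma_pdf_ge0 a y : 0 <= gamma_pdf a y.
Proof.
rewrite /gamma_pdf patchE; case: ifP => // _.
by rewrite mulr_ge0 ?gamma_ker_ge0// invr_ge0 GammaFun_ge0.
Qed.

Lemma measurable_gamma_pdf a : measurable_fun [set: K] (gamma_pdf a).
Proof.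
apply/(measurable_restrictT _ _).1 => //.
by apply: measurable_funM => //; exact: measurable_gamma_ker.
Qed.

Definition gamma_law a (V : set K) : \bar K :=
  (\int[leb]_(y in V) (gamma_pdf a y)%:E)%E.

Section measure.
Variable a : K.

Let gamma_law0 : gamma_law a set0 = 0%E.
Proof. by rewrite /gamma_law integral_set0. Qed.

Let gamma_law_ge0 A : (0 <= gamma_law a A)%E.
Proof. by apply: integral_ge0 => x _; rewrite lee_fin gamma_pdf_ge0. Qed.

Let gamma_law_sigma_additive : semi_sigma_additive (gamma_law a).
Proof.
move=> /= F mF tF mUF; rewrite /gamma_law; apply: cvg_toP.
  apply: ereal_nondecreasing_is_cvgn => m n mn.
  apply: lee_sum_nneg_natr => // k _ _; apply: integral_ge0 => /= x Fkx.
  by rewrite lee_fin gamma_pdf_ge0.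
rewrite ge0_integral_bigcup//=.
- by apply/measurable_funTS/measurable_EFinP; exact: measurable_gamma_pdf.
- by move=> x _; rewrite lee_fin gamma_pdf_ge0.
Qed.

HB.instance Definition _ := isMeasure.Build _ _ _ (gamma_law a)
  gamma_law0 gamma_law_ge0 gamma_law_sigma_additive.

End measure.

Lemma integral_gamma_law a (h : K -> \bar K) : measurable_fun [set: K] h ->
  (forall x, 0 <= h x)%E ->
  (\int[gamma_law a]_x h x = \int[leb]_x (h x * (gamma_pdf a x)%:E))%E.
Proof.
move=> mh h0.
(* Lebesgue measure is carried by [measurableTypeR K]; its image under the identity lives on the
   same measurable type as [gamma_law a], as [ge0_integral_density] requires. *)
have mi : measurable_fun [set: measurableTypeR K] (id : measurableTypeR K -> K).
  by [].
pose m := pushforward leb (id : measurableTypeR K -> K).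
have mE D (f : K -> \bar K) : measurable D -> measurable_fun D f ->
    (forall x, 0 <= f x)%E -> (\int[m]_(x in D) f x = \int[leb]_(x in D) f x)%E.
  by move=> mD mf f0; rewrite ge0_integral_pushforward.
rewrite -mE//; last 2 first.
- apply: emeasurable_funM => //.
  by apply/measurable_EFinP; exact: measurable_gamma_pdf.
- by move=> x; rewrite mule_ge0// lee_fin gamma_pdf_ge0.
apply: ge0_integral_density => //.
- by move=> x; exact: gamma_pdf_ge0.
- exact: measurable_gamma_pdf.
- move=> A mA; rewrite mE//; last by move=> x; rewrite lee_fin gamma_pdf_ge0.
  by apply/measurable_funTS/measurable_EFinP; exact: measurable_gamma_pdf.
Qed.

Lemma laplace_gamma_law a t : 0 < a -> 0 <= t ->
  (\int[gamma_law a]_y (expR (- (t * y)))%:E = ((1 + t) `^ (- a))%:E)%E.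
Proof.
move=> a0 t0; rewrite integral_gamma_law; last first.
- by move=> y; rewrite lee_fin expR_ge0.
- apply/measurable_EFinP; apply: measurableT_comp; first exact: measurable_expR.
  by apply: measurableT_comp => //; exact: measurable_funM.
have G0 := GammaFun_gt0 a0.
transitivity (\int[leb]_(y in `[0%R, +oo[)
  ((GammaFun a)^-1%:E * (expR (- ((1 + t) * y)) * y `^ (a - 1))%:E))%E.
  rewrite [RHS]integral_mkcond; apply: eq_integral => y _.
  rewrite /gamma_pdf !patchE; case: ifP => _; last by rewrite mule0.
  by rewrite -!EFinM /gamma_ker mulrDl mul1r opprD expRD; congr (_%:E); ring.
rewrite ge0_integralZl//.
- rewrite integral_gamma_ker_scale//; last by rewrite ltr_wpDr.
  by rewrite -EFinM mulrCA mulVf ?gt_eqF// mulr1.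
- apply/measurable_EFinP; apply: measurable_funTS; apply: measurable_funM.
    apply: measurableT_comp; first exact: measurable_expR.
    by apply: measurableT_comp => //; exact: measurable_funM.
  exact: measurable_powR.
- by move=> y _; rewrite lee_fin mulr_ge0 ?expR_ge0 ?powR_ge0.
- by rewrite lee_fin invr_ge0 ltW.
Qed.

Lemma gamma_lawT a : 0 < a -> gamma_law a [set: K] = 1%E.
Proof.
move=> a0; have := laplace_gamma_law a0 (lexx 0).
rewrite addr0 powR1 => <-.
under eq_integral do rewrite mul0r oppr0 expR0.
by rewrite integral_cst// mul1e.
Qed.

Lemma gamma_law_ge0_set a : 0 < a -> gamma_law a [set y | 0 <= y] = 1%E.
Proof.
move=> a0; rewrite -(gamma_lawT a0) /gamma_law.
rewrite (_ : [set y | 0 <= y] = `[0, +oo[%classic); last first.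
  by apply/seteqP; split => y /=; rewrite in_itv/= andbT.
rewrite integral_mkcond; apply: eq_integral => y _.
rewrite /gamma_pdf !patchE; case: ifP => [H|H]; rewrite ?H //.
Qed.

Lemma gamma_law_cdf a x : 0 < a -> gamma_law a [set y | y <= x] = (gamma_cdf a x)%:E.
Proof.
move=> a0.
have mx : measurable [set y : K | y <= x].
  rewrite (_ : [set y | y <= x] = `]-oo, x]%classic) //.
have E : gamma_law a [set y | y <= x] = (\int[leb]_(y in `[0%R, x])
    ((GammaFun a)^-1 * expR (- y) * y `^ (a - 1))%:E)%E.
  rewrite /gamma_law integral_mkcond [RHS]integral_mkcond.
  apply: eq_integral => y _; rewrite !patchE /gamma_pdf patchE.
  have -> : (y \in `[0, x]%classic) =
      (y \in [set y | y <= x]) && (y \in `[0, +oo[%classic).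
    rewrite !mem_setE/= !in_itv/= andbT andbC; congr andb.
  by do 2 case: ifP => //=; rewrite /gamma_ker mulrA.
rewrite /gamma_cdf /Rintegral -E fineK// ge0_fin_numE//.
by apply: (@le_lt_trans _ _ (gamma_law a setT)); [rewrite le_measure ?inE|
    rewrite gamma_lawT// ltry].
Qed.

End gamma_law.

(** * Noncentral gamma laws and damping of a coordinate *)

Section poisson_weight.
Context {K : realType}.

(** Cutting [l] off at 0 keeps the weights nonnegative for every real [l], so that the mixtures
    below form a kernel defined and measurable on all of [K]. *)
Definition poisson_weight (l : K) (k : nat) : K :=
  expR (- Num.max 0 l) * (Num.max 0 l ^+ k / k`!%:R).

Lemma poisson_weight_ge0 l k : 0 <= poisson_weight l k.
Proof.
by rewrite mulr_ge0 ?expR_ge0// divr_ge0// exprn_ge0// le_max lexx.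
Qed.

Lemma measurable_poisson_weight k : measurable_fun [set: K] (poisson_weight ^~ k).
Proof.
have mm : measurable_fun [set: K] (fun l : K => Num.max 0 l).
    by apply: (@measurable_maxr _ _ _ _ (cst 0) id) => //; exact: measurable_id.
apply: measurable_funM.
  apply: measurableT_comp; first exact: measurable_expR.
  exact: measurableT_comp.
by apply: measurable_funM => //; exact: measurable_funX.
Qed.

Lemma poisson_weight_sum (l c : K) : 0 <= l -> 0 <= c ->
  (\sum_(0 <= k <oo) (poisson_weight l k * c ^+ k)%:E = (expR (l * c - l))%:E)%E.
Proof.
move=> l0 c0; rewrite /poisson_weight max_r//.
transitivity (\sum_(0 <= k <oo) ((expR (- l))%:E * ((l * c) ^+ k / k`!%:R)%:E))%E.
  by apply: eq_eseriesr => k _; rewrite -EFinM exprMn; congr (_%:E); ring.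
rewrite nneseriesZl//=; last first.
  by move=> k _; rewrite lee_fin divr_ge0// exprn_ge0// mulr_ge0.
have -> : expR (l * c - l) = expR (- l) * expR (l * c) by rewrite -expRD addrC.
rewrite EFinM; congr (_ * _)%E.
rewrite expRE -EFin_lim; last first.
  rewrite /pseries/=; under eq_fun do rewrite mulrC.
  exact: is_cvg_series_exp_coeff.
apply/congr_lim/funext => n/=; rewrite /pseries/= /series/= -sumEFin//.
by under eq_bigr do rewrite mulrC.
Qed.

End poisson_weight.

Section ncgamma.
Context {K : realType}.
Variable a : {posnum K}.

(** The noncentral gamma law is a Poisson mixture of gamma laws of shapes [a + k]. *)
Definition ncgamma_term (l : K) (k : nat) : {measure set K -> \bar K} :=
  mscale (NngNum (poisson_weight_ge0 l k)) (gamma_law (a%:num + k%:R)).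

Definition ncgamma (l : K) : set K -> \bar K := mseries (ncgamma_term l) 0.

HB.instance Definition _ l := Measure.copy (ncgamma l) (mseries (ncgamma_term l) 0).

Lemma integral_ncgamma (l : K) (h : K -> \bar K) : measurable_fun [set: K] h ->
  (forall y, 0 <= h y)%E ->
  (\int[ncgamma l]_y h y = \sum_(0 <= k <oo)
    ((poisson_weight l k)%:E * \int[gamma_law (a%:num + k%:R)]_y h y))%E.
Proof.
move=> mh h0; rewrite ge0_integral_measure_series//.
by apply: eq_eseriesr => k _; rewrite ge0_integral_mscale.
Qed.

(** The component of shape [a + k] contributes the factor [(1 + t)^-1 ^+ k], so the mixture is the
    Poisson generating function at [(1 + t)^-1], with exponent [l / (1 + t) - l]. *)
Lemma laplace_ncgamma l t : 0 <= l -> 0 <= t ->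
  (\int[ncgamma l]_y (expR (- (t * y)))%:E =
   ((1 + t) `^ (- a%:num) * expR (- (l * (t / (1 + t)))))%:E)%E.
Proof.
move=> l0 t0; have t1 : 0 < 1 + t by rewrite ltr_wpDr.
rewrite integral_ncgamma; last first.
- by move=> y; rewrite lee_fin expR_ge0.
- apply/measurable_EFinP; apply: measurableT_comp; first exact: measurable_expR.
  by apply: measurableT_comp => //; exact: measurable_funM.
transitivity (\sum_(0 <= k <oo) (((1 + t) `^ (- a%:num))%:E *
    (poisson_weight l k * (1 + t)^-1 ^+ k)%:E))%E.
  apply: eq_eseriesr => k _; rewrite laplace_gamma_law// -!EFinM opprD.
  rewrite powRD; last by rewrite (gt_eqF t1) implybT.
  by rewrite powR_invn ?(ltW t1)// exprVn; congr (_%:E); ring.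
rewrite nneseriesZl//; last first.
  move=> k _; rewrite lee_fin mulr_ge0 ?poisson_weight_ge0// exprn_ge0// invr_ge0.
  exact: ltW.
rewrite poisson_weight_sum ?invr_ge0 ?(ltW t1)// -EFinM.
by congr (_ * expR _)%:E; field; rewrite gt_eqF.
Qed.

Lemma ncgamma_mass l (A : set K) : 0 <= l -> measurable A ->
  (forall k, gamma_law (a%:num + k%:R) A = 1%E) -> ncgamma l A = 1%E.
Proof.
move=> l0 mA A1.
transitivity (\sum_(0 <= k <oo) (poisson_weight l k * 1 ^+ k)%:E)%E.
  rewrite /ncgamma /mseries; apply: eq_eseriesr => k _.
  rewrite expr1n mulr1 -[LHS]/((poisson_weight l k)%:E * gamma_law _ A)%E.
  by rewrite A1 mule1.
by rewrite poisson_weight_sum// mulr1 subrr expR0.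
Qed.

Lemma ncgammaN (l : K) : l <= 0 -> ncgamma l = ncgamma 0.
Proof.
move=> l0; rewrite /ncgamma /ncgamma_term /mseries; apply/funext => A.
apply: eq_eseriesr => k _.
transitivity ((poisson_weight l k)%:E * gamma_law (a%:num + k%:R) A)%E => //.
transitivity ((poisson_weight 0 k)%:E * gamma_law (a%:num + k%:R) A)%E => //.
by rewrite /poisson_weight (max_l l0) (max_l (lexx 0)).
Qed.

Let ncgammaT l : (ncgamma l [set: K] <= 1)%E.
Proof.
have [l0|/ltW l0] := leP 0 l; last rewrite (ncgammaN l0).
  by rewrite ncgamma_mass// => k; exact: gamma_lawT.
by rewrite ncgamma_mass// => k; exact: gamma_lawT.
Qed.

HB.instance Definition _ l :=
  Measure_isSubProbability.Build _ _ _ (ncgamma l) (ncgammaT l).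

Lemma measurable_ncgamma :
  measurable_fun [set: K] (ncgamma : K -> giry K K).
Proof.
apply: measurable_giry_codensity => // B mB.
apply: ge0_emeasurable_sum => [k x _ _|k _]; first exact: measure_ge0.
rewrite /ncgamma_term /mscale/=; apply: emeasurable_funM => //.
by apply/measurable_EFinP; exact: measurable_poisson_weight.
Qed.

End ncgamma.

Section unit_mass.
Context d (T : measurableType d) (K : realType) (nu : {measure set T -> \bar K}).
Hypothesis nuT : nu [set: T] = 1%E.

(** The Giry constructions yield subprobabilities. Carrying the proof of total mass 1 as an argument
    lets the probability instance be attached to such a measure. *)
Definition unit_mass_prob of nu [set: T] = 1%E : set T -> \bar K := nu.

HB.instance Definition _ := Measure.copy (unit_mass_prob nuT) nu.

HB.instance Definition _ :=
  Measure_isProbability.Build _ _ _ (unit_mass_prob nuT) nuT.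

End unit_mass.

Section damping.
Context {K : realType} (n : nat).
Implicit Types (t : 'rV[K]_n) (i : 'I_n).
Local Notation T := (n.-tuple K).

Definition replace_coord i (c : K) (p : T * K) : T :=
  [tuple if j == i then c * p.2 else tnth p.1 j | j < n].

Lemma tnth_replace_coord i c p j :
  tnth (replace_coord i c p) j = if j == i then c * p.2 else tnth p.1 j.
Proof. by rewrite tnth_mktuple. Qed.

Lemma measurable_replace_coord i c : measurable_fun [set: T * K] (replace_coord i c).
Proof.
apply/measurable_fun_tnthP => j.
under [X in measurable_fun _ X]eq_fun do rewrite /= tnth_replace_coord.
case: eqP => _.
  by apply: measurable_funM => //.
exact: (measurableT_comp (measurable_tnth j) measurable_fst).
Qed.

Definition damp_kernel (a : {posnum K}) (l c : K) i (y : T) : giry T K :=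
  giry_map (measurable_replace_coord i c)
    (giry_prod (giry_ret y, ncgamma a (l * tnth y i) : giry K K)).

Lemma measurable_damp_kernel a l c i :
  measurable_fun [set: T] (damp_kernel a l c i).
Proof.
apply: (@measurableT_comp _ _ _ _ _ _ (giry_map (measurable_replace_coord i c))).
  exact: measurable_giry_map.
apply: (@measurableT_comp _ _ _ _ _ _ (@giry_prod _ _ T K K)).
  exact: measurable_giry_prod.
apply/measurable_fun_pairP; split => /=.
  exact: measurable_giry_ret.
apply: (@measurableT_comp _ _ _ _ _ _ (ncgamma a : K -> giry K K)).
  exact: measurable_ncgamma.
by apply: measurable_funM => //; exact: measurable_tnth.
Qed.

Lemma integral_damp_kernel a l c i y (h : T -> \bar K) :
  measurable_fun [set: T] h -> (forall x, 0 <= h x)%E ->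
  (\int[damp_kernel a l c i y]_x h x =
   \int[ncgamma a (l * tnth y i)]_z h (replace_coord i c (y, z)))%E.
Proof.
move=> mh h0; have mr := measurable_replace_coord i c.
have mhr : measurable_fun [set: T * K] (h \o replace_coord i c).
  exact: (measurableT_comp mh mr).
rewrite -[LHS]/(giry_int _ _) giry_int_map// giry_int_prod1//.
- rewrite giry_int_ret//.
  apply: (@measurable_fun_fubini_tonelli_F _ _ _ _ _
    (ncgamma a (l * tnth y i) : giry K K) (h \o replace_coord i c)) => //.
  by move=> x; exact: h0.
- by move=> x; exact: h0.
Qed.

Lemma measurable_orthant : measurable [set y : T | forall j, 0 <= tnth y j].
Proof.
rewrite (_ : mkset _ = \bigcap_(j in [set: 'I_n]) [set y : T | 0 <= tnth y j]).
  apply: fin_bigcap_measurable => // j _.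
  rewrite (_ : [set y : T | 0 <= tnth y j] =
    setT `&` (@tnth _ _ ^~ j) @^-1` `[0, +oo[%classic); last first.
    by rewrite setTI; apply/seteqP; split => y /=; rewrite in_itv/= andbT.
  exact: measurable_tnth.
by apply/seteqP; split => [y /= h j _|y h j]; apply: h.
Qed.

Lemma measurable_laplace t :
  measurable_fun [set: T] (fun y => (expR (- \sum_j t 0 j * tnth y j))%:E).
Proof.
apply/measurable_EFinP; apply: measurableT_comp; first exact: measurable_expR.
apply: measurableT_comp => //; apply: measurable_sum => j.
by apply: measurable_funM => //; exact: measurable_tnth.
Qed.

(** Given [y], the new coordinate contributes a power of [1 + (1 - th) * t 0 i] times an exponential
    linear in [tnth y i]. That exponential joins the remaining factors, so integrating over [mu]
    evaluates [phi] at a modified argument. *)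
Lemma laplace_damp (al : {posnum K}) (th : K) i (mu : probability T K)
    (phi : 'rV[K]_n -> K) : 0 <= th < 1 -> is_laplace_transform mu phi ->
  exists nu : probability T K, is_laplace_transform nu (fun t =>
    (1 + (1 - th) * t 0 i) `^ (- al%:num) *
    phi (\row_j if j == i then th * t 0 i / (1 + (1 - th) * t 0 i) else t 0 j)).
Proof.
move=> /andP[th0 th1] [mu0 muL].
(* With [l * c = th], the noncentral exponent at [c * t 0 i] is exactly
   [th * t 0 i / (1 + (1 - th) * t 0 i)] times [tnth y i]. *)
pose l := th / (1 - th); pose c := 1 - th.
have c0 : 0 < c by rewrite subr_gt0.
have l0 : 0 <= l by rewrite divr_ge0// ltW.
pose f := damp_kernel al l c i.
have mf : measurable_fun setT f by exact: measurable_damp_kernel.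
pose nu := giry_bind (mu : giry T K) mf.
have nuE (h : T -> \bar K) : measurable_fun [set: T] h -> (forall x, 0 <= h x)%E ->
    (\int[nu]_x h x = \int[mu]_y \int[ncgamma al (l * tnth y i)]_z
      h (replace_coord i c (y, z)))%E.
  move=> mh h0; rewrite -[LHS]/(giry_int _ _) giry_int_bind//.
  by apply: eq_integral => y _; rewrite -integral_damp_kernel.
have mT0 := @measurable_orthant.
have mint (h : T -> \bar K) : measurable_fun [set: T] h -> (forall x, 0 <= h x)%E ->
    measurable_fun [set: T] (fun y : T =>
      \int[ncgamma al (l * tnth y i)]_z h (replace_coord i c (y, z)))%E.
  move=> mh h0; have := measurableT_comp (measurable_giry_int mh h0) mf.
  congr (measurable_fun _ _); apply/funext => y /=.
  by rewrite -integral_damp_kernel.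
(* The noncentral transform formula needs a nonnegative parameter, which [l * tnth y i] is only on
   the orthant, hence almost everywhere for [mu]. *)
have muE (g h : T -> \bar K) : measurable_fun [set: T] g ->
    measurable_fun [set: T] h ->
    (forall y : T, (forall j, 0 <= tnth y j) -> g y = h y) ->
    (\int[mu]_y g y = \int[mu]_y h y)%E.
  move=> mg mh gh; apply: ae_eq_integral => //.
  exists (~` [set y : T | forall j, 0 <= tnth y j]); split.
  - exact: measurableC.
  - apply: etrans; first exact: (probability_setC mu mT0).
    by rewrite mu0 subee.
  - by move=> y /= ngh Ty; apply: ngh => _; exact: gh.
have nuT0 : nu [set y | forall j, 0 <= tnth y j] = 1%E.
  set A := [set y | _].
  have mA : measurable_fun [set: T] (fun x => (\1_A x)%:E : \bar K).
    by apply/measurable_EFinP.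
  rewrite -(setIT A) -integral_indic//.
  rewrite nuE//.
  rewrite (muE _ (cst 1%E))//.
  - by rewrite integral_cst// mul1e; exact: (@probability_setT _ _ _ mu).
  - by apply: (mint (fun x => (\1_A x)%:E)) => // x; rewrite lee_fin.
  - move=> y y0.
    have mz : measurable [set z : K | 0 <= z].
      rewrite (_ : [set z | 0 <= z] = `[0, +oo[%classic) //.
      by apply/seteqP; split => z /=; rewrite in_itv/= andbT.
    rewrite -[RHS](@ncgamma_mass _ al (l * tnth y i) [set z | 0 <= z])//.
    + rewrite -[in RHS](setIT [set z | 0 <= z]) -integral_indic//.
      apply: eq_integral => z _; rewrite !indicE.
      suff -> : (replace_coord i c (y, z) \in A) = (z \in [set z | 0 <= z]) by [].
      apply/idP/idP; rewrite !inE/= => h.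
        by have := h i; rewrite tnth_replace_coord eqxx/= pmulr_rge0.
      move=> j; rewrite tnth_replace_coord; case: eqP => //= _.
      by rewrite mulr_ge0// ltW.
    + by rewrite mulr_ge0.
    + by move=> k; rewrite gamma_law_ge0_set// ltr_wpDr.
have nuT : nu [set: T] = 1%E.
  apply/eqP; rewrite eq_le sprobability_setT/= -nuT0.
  by apply: le_measure; rewrite ?inE.
exists (unit_mass_prob nuT : probability T K); split => // t t0.
have mh : measurable_fun [set: T] (fun y => (expR (- \sum_j t 0 j * tnth y j))%:E).
  exact: measurable_laplace.
rewrite -[LHS]/(\int[nu]_y _)%E nuE//.
set t' := \row_j _; set C := _ `^ _.
have t'0 j : 0 <= t' 0 j.
  rewrite mxE; case: ifP => // _; rewrite divr_ge0 ?mulr_ge0// addr_ge0// mulr_ge0//.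
  by rewrite ltW.
rewrite (muE _ (fun y => C%:E * (expR (- \sum_j t' 0 j * tnth y j))%:E)%E).
- rewrite ge0_integralZl//; first by rewrite muL.
  + exact: measurable_laplace.
  + by rewrite lee_fin powR_ge0.
- apply: (mint (fun x => (expR (- \sum_j t 0 j * tnth x j))%:E)) => //.
- apply/measurable_EFinP; apply: measurable_funM => //.
  by apply/measurable_EFinP; exact: measurable_laplace.
- move=> y y0.
  transitivity (\int[ncgamma al (l * tnth y i)]_z
     ((expR (- \sum_(j | j != i) t 0 j * tnth y j))%:E *
      (expR (- (c * t 0 i * z)))%:E))%E.
    apply: eq_integral => z _; rewrite -EFinM -expRD -opprD; congr (expR (- _))%:E.
    rewrite (bigD1 i)//= tnth_replace_coord eqxx/= addrC; congr (_ + _).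
      by apply: eq_bigr => j /negbTE ji; rewrite tnth_replace_coord ji.
    by ring.
  rewrite ge0_integralZl//.
  + have ly0 : 0 <= l * tnth y i by rewrite mulr_ge0.
    have ct0 : 0 <= c * t 0 i by rewrite mulr_ge0// ltW.
    rewrite laplace_ncgamma// -!EFinM; congr (_%:E).
    rewrite mulrCA -/C; congr (_ * _); rewrite -expRD -opprD; congr (expR (- _)).
    rewrite [RHS](bigD1 i)//= [RHS]addrC; congr (_ + _).
      by apply: eq_bigr => j /negbTE ji; rewrite /t' mxE ji.
    rewrite /t' mxE eqxx /l -/c; field.
    by rewrite !gt_eqF// ltr_wpDr.
  + apply/measurable_EFinP; apply: measurableT_comp; first exact: measurable_expR.
    by apply: measurableT_comp => //; exact: measurable_funM.
Qed.

End damping.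

(** * Positive functionals on polynomials over the cube *)

Section limits.
Context {K : realType}.

Lemma cvg_sumr (I : Type) (s : seq I) (P : pred I) (f : I -> K^nat) (l : I -> K) :
  (forall i, P i -> f i N @[N --> \oo] --> l i) ->
  \sum_(i <- s | P i) f i N @[N --> \oo] --> \sum_(i <- s | P i) l i.
Proof.
move=> fl; elim: s => [|i s ih].
  rewrite big_nil; under eq_cvg do rewrite big_nil; exact: cvg_cst.
rewrite big_cons; under eq_cvg do rewrite big_cons.
by case: ifPn => // Pi; apply: cvgD => //; exact: fl.
Qed.

Lemma cvg_prodr (I : Type) (s : seq I) (P : pred I) (f : I -> K^nat) (l : I -> K) :
  (forall i, P i -> f i N @[N --> \oo] --> l i) ->
  \prod_(i <- s | P i) f i N @[N --> \oo] --> \prod_(i <- s | P i) l i.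
Proof.
move=> fl; elim: s => [|i s ih].
  rewrite big_nil; under eq_cvg do rewrite big_nil; exact: cvg_cst.
rewrite big_cons; under eq_cvg do rewrite big_cons.
by case: ifPn => // Pi; apply: cvgM => //; exact: fl.
Qed.

Lemma cvg_ge_lim (u : K^nat) (l c : K) : u N @[N --> \oo] --> l ->
  (forall N, c <= u N) -> c <= l.
Proof. by move=> ul cu; apply: (cvgr_to_ge ul); exact: nearW. Qed.

Lemma cvg_le_lim (u v : K^nat) (l m : K) : u N @[N --> \oo] --> l ->
  v N @[N --> \oo] --> m -> (forall N, u N <= v N) -> l <= m.
Proof. by move=> ul vm uv; apply: (ler_cvg_to ul vm); exact: nearW. Qed.

(** The difference quotient at 0 of [h |-> expR (h * x)], taken along [h = 1 / N.+1]. *)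
Lemma cvg_expR_slope (x : K) :
  N.+1%:R * (expR (N.+1%:R^-1 * x) - 1) @[N --> \oo] --> x.
Proof.
have d : is_derive (0 : K) 1 (fun h => expR (h * x)) x.
  have dm : is_derive (0 : K) 1 (fun h : K => h * x) x.
    by apply: is_derive_eq; rewrite scaler0 add0r -[_ *: _]/(_ * _) mulr1.
  have de : is_derive ((fun h : K => h * x) 0) 1 (@expR K) 1.
    by rewrite /= mul0r; apply: is_derive_eq; rewrite expR0.
  by have := @is_derive1_comp _ expR ( *%R^~ x) _ _ _ de dm; rewrite mul1r.
have := @ex_derive _ _ _ _ _ _ _ d => /cvg_ex[/= l dl].
have xl : l = x.
  by rewrite -(@derive_val _ _ _ _ _ _ _ d) /derive; apply/esym/cvg_lim.
move: dl; rewrite xl => /cvg_dnbhs_at_right/cvg_at_rightP.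
move=> /(_ (fun N => N.+1%:R^-1)); rewrite /= => h; move: h; rewrite (_ : (fun N : nat => _ *: _) =
  (fun N => N.+1%:R * (expR (N.+1%:R^-1 * x) - 1))); last first.
  by apply/funext => N; rewrite invrK mul0r expR0 addr0 -[_%:A]/(_ * _) mulr1.
by apply; split; [move=> N; rewrite invr_gt0|exact: cvg_harmonic].
Qed.

End limits.

Section moment_positive.
Context {K : realType} {n : nat}.
Local Notation expo := ('I_n -> nat).

Definition cube (u : 'I_n -> K) := forall j, 0 <= u j <= 1.

Definition mono (u : 'I_n -> K) (k : expo) : K := \prod_j u j ^+ k j.

(* The functional [u^k |-> f k] is nonnegative on the polynomials that are
   nonnegative on the cube; [cmpos] asks this only of those vanishing at
   [(1, .., 1)]. *)
Definition mpos (f : expo -> K) := forall (I : finType) (a : I -> K) (k : I -> expo),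
  (forall u, cube u -> 0 <= \sum_i a i * mono u (k i)) ->
  0 <= \sum_i a i * f (k i).

Definition cmpos (f : expo -> K) := forall (I : finType) (a : I -> K) (k : I -> expo),
  \sum_i a i = 0 ->
  (forall u, cube u -> 0 <= \sum_i a i * mono u (k i)) ->
  0 <= \sum_i a i * f (k i).

Implicit Types f g : expo -> K.

Lemma mono1 k : mono (fun=> 1) k = 1.
Proof. by rewrite /mono big1// => j _; rewrite expr1n. Qed.

Lemma mono_ge0 u k : cube u -> 0 <= mono u k.
Proof. by move=> u01; apply: prodr_ge0 => j _; rewrite exprn_ge0//; case/andP: (u01 j). Qed.

Lemma monoM u v k : mono u k * mono v k = mono (fun j => u j * v j) k.
Proof. by rewrite /mono -big_split; apply: eq_bigr => j _; rewrite exprMn. Qed.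

Lemma mpos_cst (c : K) : 0 <= c -> mpos (fun=> c).
Proof.
move=> c0 I a k /(_ (fun=> 1)) h; rewrite -mulr_suml mulr_ge0//.
under eq_bigr => i _ do rewrite -(mulr1 (a i)) -(mono1 (k i)).
by apply: h => j; rewrite ler01 lexx.
Qed.

Lemma mposD f g : mpos f -> mpos g -> mpos (fun k => f k + g k).
Proof.
move=> pf pg I a k h; under eq_bigr do rewrite mulrDr.
by rewrite big_split addr_ge0//; [exact: pf|exact: pg].
Qed.

(** A polynomial nonnegative on the cube, evaluated at the coordinatewise product of [u] and [v], is
    nonnegative in each separately. For laws this is the product of two independent vectors. *)
Lemma mposM f g : mpos f -> mpos g -> mpos (fun k => f k * g k).
Proof.
move=> pf pg I a k h; under eq_bigr do rewrite [f _ * _]mulrC mulrA.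
apply: pf => u u01; under eq_bigr do rewrite mulrAC.
apply: pg => v v01; under eq_bigr do rewrite -mulrA monoM.
apply: h => j; move: (u01 j) (v01 j) => /andP[u0 u1] /andP[v0 v1].
by rewrite mulr_ge0// mulr_ile1.
Qed.

Lemma mposX f m : mpos f -> mpos (fun k => f k ^+ m).
Proof.
move=> pf; elim: m => [|m ih]; first by (under eq_fun do rewrite expr0); exact: (@mpos_cst 1 ler01).
by (under eq_fun do rewrite exprS); exact: (mposM pf ih).
Qed.

Lemma mpos_sum (I : Type) (s : seq I) (P : pred I) (f : I -> expo -> K) :
  (forall i, P i -> mpos (f i)) -> mpos (fun k => \sum_(i <- s | P i) f i k).
Proof.
move=> pf; elim: s => [|i s ih].
  by (under eq_fun do rewrite big_nil); exact: (@mpos_cst 0 (lexx 0)).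
have [Pi|/negbTE nPi] := boolP (P i).
  by (under eq_fun do rewrite big_cons Pi); exact: (mposD (pf i Pi) ih).
by (under eq_fun do rewrite big_cons nPi); exact: ih.
Qed.

Lemma mpos_prod (I : Type) (s : seq I) (P : pred I) (f : I -> expo -> K) :
  (forall i, P i -> mpos (f i)) -> mpos (fun k => \prod_(i <- s | P i) f i k).
Proof.
move=> pf; elim: s => [|i s ih].
  by (under eq_fun do rewrite big_nil); exact: (@mpos_cst 1 ler01).
have [Pi|/negbTE nPi] := boolP (P i).
  by (under eq_fun do rewrite big_cons Pi); exact: (mposM (pf i Pi) ih).
by (under eq_fun do rewrite big_cons nPi); exact: ih.
Qed.

Lemma mpos_lim (F : nat -> expo -> K) f : (forall N, mpos (F N)) ->
  (forall k, F N k @[N --> \oo] --> f k) -> mpos f.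
Proof.
move=> pF Ff I a k h.
apply: (@cvg_ge_lim _ (fun N => \sum_i a i * F N (k i))); last by move=> N; exact: pF.
by apply: cvg_sumr => i _; apply: cvgM; [exact: cvg_cst|exact: Ff].
Qed.

(** The exponential series without its constant term has nonnegative coefficients, and powers of [f]
    are positive. Removing the 1 is what later gives a comparison and not just positivity. *)
Lemma mpos_expR f : mpos f -> mpos (fun k => expR (f k) - 1).
Proof.
move=> pf; apply: (@mpos_lim (fun N k => \sum_(0 <= m < N) f k ^+ m.+1 / m.+1`!%:R)) => [N|k].
  apply: mpos_sum => m _; apply: mposM; first exact: mposX.
  by apply: mpos_cst; rewrite invr_ge0.
have h : series (exp_coeff (f k)) (N + 1)%N @[N --> \oo] --> expR (f k).
  by rewrite (cvg_shiftn 1%N); exact: is_cvg_series_exp_coeff.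
have {h} : series (exp_coeff (f k)) (N + 1)%N - 1 @[N --> \oo] --> expR (f k) - 1.
  by apply: cvgB => //; exact: cvg_cst.
rewrite (_ : (fun N => _ - 1) =
  (fun N => \sum_(0 <= m < N) f k ^+ m.+1 / m.+1`!%:R)) //.
apply/funext => N; rewrite addn1 seriesEnat /= big_nat_recl//= {1}/exp_coeff/=.
by rewrite expr0 fact0 divr1 addrC addKr.
Qed.

Lemma cmpos_ln (D : expo -> K) : (forall k, 0 < D k) ->
  (forall al, 0 < al -> mpos (fun k => D k `^ (- al))) ->
  cmpos (fun k => - ln (D k)).
Proof.
move=> D0 pD I a k a0 h.
apply: (@cvg_ge_lim _ (fun N => \sum_i a i *
   (N.+1%:R * (expR (N.+1%:R^-1 * - ln (D (k i))) - 1)))).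
  apply: cvg_sumr => i _; apply: cvgM; [exact: cvg_cst|exact: cvg_expR_slope].
move=> N; under eq_bigr do rewrite mulrCA mulrBr mulr1.
rewrite -mulr_sumr mulr_ge0// sumrB a0 subr0.
have := pD N.+1%:R^-1; rewrite invr_gt0 ltr0n => /(_ isT I a k h).
under eq_bigr do rewrite /powR gt_eqF// mulNr -mulrN.
by [].
Qed.

End moment_positive.

(** * Multiaffine functions of integer points *)

Section multiaffine.
Local Open Scope set_scope.
Context {K : realType} {n : nat}.
Local Notation expo := ('I_n -> nat).
Implicit Types (d : {set 'I_n} -> K) (A S : {set 'I_n}) (k : expo).

Definition mafun d (t : 'I_n -> K) : K := \sum_(S : {set 'I_n}) d S * \prod_(j in S) t j.

Definition manat d k : K := mafun d (fun j => (k j)%:R).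

Definition shift_on A (N : nat) k : expo := fun j => if j \in A then (k j + N.+1)%N else k j.

(** The coefficient in [manat d] of the product of all variables in [A], still a function of the
    variables off [A]: only the [S] containing [A] contribute. *)
Definition malim d A k : K :=
  \sum_S d S * \prod_j (if j \in A then (j \in S)%:R else if j \in S then (k j)%:R else 1).

Lemma cvg_natD_ratio (p : nat) : (p + N.+1)%:R / N.+1%:R @[N --> \oo] --> (1 : K).
Proof.
rewrite (_ : (fun N => _) = (fun N => p%:R * N.+1%:R^-1 + 1)); last first.
  by apply/funext => N; rewrite natrD mulrDl divff ?pnatr_eq0.
rewrite -[X in _ --> X]add0r -[X in _ --> X + _](mulr0 p%:R).
apply: cvgD; last exact: cvg_cst.
by apply: cvgM; [exact: cvg_cst|exact: cvg_harmonic].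
Qed.

Lemma manat_shift_lim d A k :
  manat d (shift_on A N k) / N.+1%:R ^+ #|A| @[N --> \oo] --> malim d A k.
Proof.
rewrite (_ : (fun N => _) = (fun N => \sum_S d S * \prod_j
    ((if j \in S then (shift_on A N k j)%:R else 1) *
     (if j \in A then N.+1%:R^-1 else 1)))); last first.
  apply/funext => N; rewrite /manat /mafun mulr_suml; apply: eq_bigr => S _.
  rewrite -mulrA big_split/= -!big_mkcond/= prodr_const; congr (_ * (_ * _)).
  by rewrite exprVn.
apply: cvg_sumr => S _; apply: cvgM; first exact: cvg_cst.
apply: cvg_prodr => j _; rewrite /shift_on.
case: (j \in S); case: (j \in A).
- exact: cvg_natD_ratio.
- by rewrite mulr1; exact: cvg_cst.
- by (under eq_fun do rewrite mul1r); exact: cvg_harmonic.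
- by rewrite mulr1; exact: cvg_cst.
Qed.

Lemma malim_setT d k : malim d [set: 'I_n] k = d [set: 'I_n].
Proof.
rewrite /malim (bigD1 [set: 'I_n])//= [X in _ + X]big1 ?addr0; last first.
  move=> S; rewrite -finset.subTset => /fintype.subsetPn[j _ jS].
  by rewrite (bigD1 j)//= inE (negbTE jS) mul0r mulr0.
by rewrite big1 ?mulr1// => j _; rewrite !inE.
Qed.

Lemma malim_0 d A : malim d A (fun=> 0%N) = d A.
Proof.
rewrite /malim (bigD1 A)//= [X in _ + X]big1 ?addr0.
  by rewrite big1 ?mulr1// => j _; case: (j \in A).
move=> S; rewrite finset.eqEsubset negb_and => /orP[] /fintype.subsetPn[j j1 /negbTE j2];
  by rewrite (bigD1 j)//= j2 ?j1 mul0r mulr0.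
Qed.

Lemma malim_setC1 d j k :
  malim d [set~ j] k = d [set~ j] + d [set: 'I_n] * (k j)%:R.
Proof.
have jT : [set~ j] != [set: 'I_n] by apply/eqP => /setP/(_ j); rewrite !inE eqxx.
rewrite /malim (bigD1 [set~ j])//= (bigD1 [set: 'I_n]) 1?eq_sym//= [X in _ + (_ + X)]big1 ?addr0.
  congr (_ + _ * _).
    by rewrite big1 ?mulr1// => l _; case: (l \in _).
  rewrite (bigD1 j)//= !inE eqxx/= big1 ?mulr1// => l lj.
  by rewrite !inE lj.
move=> S /andP[Sj ST].
have [l lj lS] : exists2 l, l != j & l \notin S.
  apply/exists_inP; apply: contraNT Sj; rewrite negb_exists_in => /forall_inP h.
  have sub : [set~ j] \subset S by apply/fintype.subsetP => l; rewrite !inE => /h; rewrite negbK.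
  have [jS|jS] := boolP (j \in S).
    move: ST; rewrite -finset.subTset; case/negP; apply/fintype.subsetP => l _.
    by have [->//|/h] := eqVneq l j; rewrite negbK.
  rewrite finset.eqEsubset sub andbT; apply/fintype.subsetP => l lS; rewrite !inE.
  by apply: contraNneq jS => <-.
by rewrite (bigD1 l)//= !inE lj (negbTE lS) mul0r mulr0.
Qed.

(** Sending the coordinates in [S] to infinity, with the others at 0, isolates [d S] as the limit of
    nonnegative quotients. *)
Lemma mafun_ge0_coef d : (forall k, 0 <= manat d k) -> forall S, 0 <= d S.
Proof.
move=> d0 S; rewrite -(malim_0 d S).
apply: (@cvg_ge_lim _ (fun N => manat d (shift_on S N (fun=> 0%N)) / N.+1%:R ^+ #|S|)).
  exact: manat_shift_lim.
move=> N; by rewrite divr_ge0// exprn_ge0.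
Qed.

End multiaffine.

(** * Consequences of infinite divisibility for a multiaffine determinant *)

Section infinitely_divisible_determinant.
Local Open Scope set_scope.
Context {K : realType} {n : nat}.
Local Notation expo := ('I_n -> nat).
Variable d : {set 'I_n} -> K.
Local Notation D := (manat d).
Hypothesis D_gt0 : forall k, 0 < D k.
Hypothesis D_mpos : forall al, 0 < al -> mpos (fun k => D k `^ (- al)).
Hypothesis D0 : D (fun=> 0%N) = 1.
Hypothesis D1 : forall j p, D (fun l => if l == j then p else 0%N) = 1 + p%:R.

Let lnD : cmpos (fun k => - ln (D k)) := cmpos_ln D_gt0 D_mpos.

Let sum_bool2 (F : bool * bool -> K) : \sum_p F p =
  F (true, true) + F (true, false) + (F (false, true) + F (false, false)).
Proof.
transitivity (\sum_b1 \sum_b2 F (b1, b2)); last by rewrite !big_bool.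
by rewrite pair_bigA; apply: eq_bigr => -[].
Qed.

(** Split the monomial [u^k] as [X * Y], with [X] the [j]-th factor. The polynomial
    [(1 - X) * (1 - Y)] is nonnegative on the cube and vanishes at (1, .., 1), so conditional
    positivity of [- ln D] compares the four corner values. *)
Lemma manat_le j (k : expo) :
  D k <= (1 + (k j)%:R) * D (fun l => if l == j then 0%N else k l).
Proof.
(* The four monomials of [(1 - X) * (1 - Y)]: the first boolean keeps [X], the second keeps [Y], and
   each kept factor brings a sign. *)
pose kk (b : bool * bool) : expo := fun l =>
  if l == j then (if b.1 then k l else 0)%N else (if b.2 then k l else 0)%N.
pose aa (b : bool * bool) : K := (-1) ^+ b.1 * (-1) ^+ b.2.
have := @lnD _ aa kk; rewrite !sum_bool2 /aa /= !expr1 !expr0.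
have kTT : kk (true, true) = k by apply/funext => l; rewrite /kk/=; case: ifP.
have kTF : kk (true, false) = (fun l => if l == j then k j else 0%N).
  by apply/funext => l; rewrite /kk/=; case: eqP => // ->.
have kFF : kk (false, false) = (fun=> 0%N).
  by apply/funext => l; rewrite /kk/=; case: eqP.
have kFT : kk (false, true) = (fun l => if l == j then 0%N else k l).
  by apply/funext => l; rewrite /kk/=.
rewrite kTT kTF kFF kFT D0 D1 ln1; set D' := D (fun l => if l == j then 0%N else k l).
have Dk := D_gt0 k; have D'0 : 0 < D' := D_gt0 _.
have k1 : 0 < 1 + (k j)%:R :> K by rewrite ltr_wpDr.
move=> h; rewrite -ler_ln ?posrE ?mulr_gt0// lnM ?posrE//.
suff : 0 <= - ln (D k) + (ln (1 + (k j)%:R) + ln D') by lra.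
have {}h := h _ _; apply: le_trans (h _ _) _; last by lra.
  by lra.
move=> u u01; rewrite sum_bool2 /= kTT kTF kFF kFT.
pose X := u j ^+ k j; pose Y := \prod_(l | l != j) u l ^+ k l.
have -> : mono u k = X * Y by rewrite /mono (bigD1 j).
have -> : mono u (fun l => if l == j then k j else 0%N) = X.
  rewrite /mono (bigD1 j)//= eqxx big1 ?mulr1// => l /negbTE ->.
  by rewrite expr0.
have -> : mono u (fun l => if l == j then 0%N else k l) = Y.
  rewrite /mono (bigD1 j)//= eqxx expr0 mul1r; apply: eq_bigr => l /negbTE ->.
  by [].
have -> : mono u (fun=> 0%N) = 1 by rewrite /mono big1// => l _; rewrite expr0.
have X1 : X <= 1 by case/andP: (u01 j) => u0 u1; exact: exprn_ile1.
have Y1 : Y <= 1.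
  apply: prodr_ile1 => l _; case/andP: (u01 l) => u0 u1.
  by rewrite exprn_ge0//= exprn_ile1.
have : 0 <= (1 - X) * (1 - Y) by rewrite mulr_ge0 ?subr_ge0.
by lra.
Qed.

Hypothesis dT_gt0 : 0 < d [set: 'I_n].
Local Notation dT := (d [set: 'I_n]).

(** [manat_le] at the points with all coordinates [N.+1], divided by the leading power, passes to
    this limit; it makes the factors [hfac] positive. *)
Lemma top_coef_le j : dT <= d [set~ j].
Proof.
rewrite -(malim_setT d (fun=> 0%N)).
have -> : d [set~ j] = 1 * malim d [set~ j] (fun=> 0%N).
  by rewrite malim_setC1 mulr0 addr0 mul1r.
apply: (@cvg_le_lim _
  (fun N => manat d (shift_on [set: 'I_n] N (fun=> 0%N)) / N.+1%:R ^+ #|[set: 'I_n]|)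
  (fun N => (1 + N.+1)%:R / N.+1%:R *
    (manat d (shift_on [set~ j] N (fun=> 0%N)) / N.+1%:R ^+ #|[set~ j]|))).
- exact: manat_shift_lim.
- by apply: cvgM; [exact: cvg_natD_ratio|exact: manat_shift_lim].
- move=> N; rewrite mulrACA -invfM -exprS cardsC1 cardsT card_ord prednK; last first.
    exact: leq_ltn_trans (leq0n j) (ltn_ord j).
  rewrite ler_pM2r ?invr_gt0 ?exprn_gt0//.
  apply: (le_trans (manat_le j _)).
  rewrite /shift_on !inE add0n natrD.
  rewrite le_eqVlt; apply/orP; left; apply/eqP; congr (_ * manat d _).
  by apply/funext => l; rewrite !inE; case: eqP.
Qed.

(** The leading coefficient of [D] in all coordinates other than [j], as a function of [p = k j]. *)
Definition hfac j (p : nat) : K := d [set~ j] + dT * p%:R.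

Lemma hfac_gt0 j p : 0 < hfac j p.
Proof. by rewrite ltr_wpDr ?mulr_ge0 ?(ltW dT_gt0)// (lt_le_trans dT_gt0)// top_coef_le. Qed.

(** Both sides are affine in each [v l]. With all [v l] in {0, 1}, the left side is the length when
    none vanishes, 1 when exactly one does, and 0 otherwise. The induction step reduces to
    [(1 - v x) * (1 - P) >= 0]. *)
Lemma sum_prod_le (I : eqType) (s : seq I) (v : I -> K) : uniq s ->
  (forall l, 0 <= v l <= 1) ->
  \sum_(j <- s) \prod_(l <- s | l != j) v l <= 1 + ((size s)%:R - 1) * \prod_(l <- s) v l.
Proof.
move=> + v01; elim: s => [_|x s ih /= /andP[xs us]].
  by rewrite !big_nil sub0r mulr1 subrr.
rewrite 2!big_cons eqxx/= big_cons.
have -> : \prod_(l <- s | l != x) v l = \prod_(l <- s) v l.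
  rewrite big_seq_cond [RHS]big_seq; apply: eq_bigl => l.
  by case: (boolP (l \in s)) => //= ls; apply: contraNneq xs => <-.
have -> : \sum_(j <- s) \prod_(l <- x :: s | l != j) v l =
    v x * \sum_(j <- s) \prod_(l <- s | l != j) v l.
  rewrite mulr_sumr !big_seq; apply: eq_bigr => j js.
  by rewrite big_cons ifT//; apply: contraNneq xs => ->.
have /andP[vx0 vx1] := v01 x.
set P := \prod_(l <- s) v l.
have P1 : P <= 1 by apply: prodr_ile1.
have := ler_wpM2l vx0 (ih us); rewrite -/P.
have : 0 <= (1 - v x) * (1 - P) by rewrite mulr_ge0// subr_ge0.
rewrite -natr1; set S := \sum_(j <- s) _; set z := (size s)%:R.
by nra.
Qed.

(** Multiplying any test polynomial by one that vanishes at (1, .., 1) gives an admissible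
    polynomial for [cmpos]; on the functional the product acts by shifting the argument. *)
Lemma cmpos_mul (f : expo -> K) (J : finType) (c : J -> K) (m : J -> expo) : cmpos f ->
  \sum_j c j = 0 -> (forall u, cube u -> 0 <= \sum_j c j * mono u (m j)) ->
  mpos (fun k => \sum_j c j * f (fun l => (k l + m j l)%N)).
Proof.
move=> cf c0 cV I a k ak.
have := cf _ (fun p : I * J => a p.1 * c p.2) (fun p l => (k p.1 l + m p.2 l)%N).
rewrite -(pair_bigA _ (fun i j => a i * c j)) -(pair_bigA _ (fun i j =>
  a i * c j * f (fun l => (k i l + m j l)%N)))/=.
under [X in _ -> _ -> 0 <= X]eq_bigr do under eq_bigr do rewrite -mulrA.
under [X in _ -> _ -> 0 <= X]eq_bigr do rewrite -mulr_sumr.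
apply.
  by rewrite big1// => i _; rewrite -mulr_sumr c0 mulr0.
move=> u u01.
rewrite -(pair_bigA _ (fun i j => a i * c j * mono u (fun l => (k i l + m j l)%N)))/=.
under eq_bigr => i _.
  under eq_bigr => j _.
    rewrite (_ : mono u _ = mono u (k i) * mono u (m j)); last first.
      by rewrite /mono -big_split; apply: eq_bigr => l _; rewrite exprD.
    rewrite mulrACA; over.
  rewrite -mulr_sumr; over.
by rewrite -mulr_suml mulr_ge0//; [exact: ak|exact: cV].
Qed.

Lemma cvg_ln (u : K^nat) (l : K) : 0 < l -> u N @[N --> \oo] --> l ->
  ln (u N) @[N --> \oo] --> ln l.
Proof. by move=> l0 ul; apply: continuous_cvg => //; exact: continuous_ln. Qed.

(** The multiplier is the difference of the two sides of [sum_prod_le] at [u_l ^+ N.+1]. In the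
    limit it is the indicator that at least two [u_l] are below 1, so it discards the part of the
    Levy measure on the coordinate axes; that part accounts for the factors [hfac]. *)
Lemma mpos_ln_ratio : mpos (fun k =>
  - ln (D k) - (n%:R - 1) * ln dT + \sum_j ln (hfac j (k j))).
Proof.
(* Coefficients and exponents of [1 + (n - 1) \prod_l v_l - \sum_j \prod_(l != j) v_l] with
   [v_l = u_l ^+ N.+1]; the coefficients add up to [1 + (n - 1) - n = 0]. *)
pose c (x : bool + 'I_n) : K :=
  match x with inl true => 1 | inl false => n%:R - 1 | inr _ => -1 end.
pose m N (x : bool + 'I_n) : expo := fun l =>
  match x with inl true => 0%N | inl false => N.+1
             | inr j => if l == j then 0%N else N.+1 end.
apply: (@mpos_lim _ _ (fun N k =>
  \sum_x c x * - ln (D (fun l => (k l + m N x l)%N)))) => [N|k].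
- apply: (@cmpos_mul (fun k => - ln (D k)) _ c (m N) lnD).
    by rewrite big_sumType big_bool/= sumr_const card_ord mulNrn; ring.
  move=> u u01; rewrite big_sumType big_bool /= mul1r.
  have -> : mono u (m N (inl true)) = 1 by rewrite /mono big1// => l _; rewrite expr0.
  pose v l := u l ^+ N.+1.
  have v01 l : 0 <= v l <= 1.
    by case/andP: (u01 l) => u0 u1; rewrite exprn_ge0//= exprn_ile1.
  have -> : mono u (m N (inl false)) = \prod_l v l by [].
  rewrite [X in _ + X](eq_bigr (fun j => - \prod_(l | l != j) v l)); last first.
    move=> j _; rewrite mulN1r; congr (- _).
    rewrite /mono (bigD1 j)//= eqxx expr0 mul1r.
    by apply: eq_bigr => l /negbTE ->.
  have := @sum_prod_le _ (index_enum 'I_n) v (index_enum_uniq _) v01.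
  rewrite (_ : size _ = n); last by rewrite -[RHS]card_ord cardT enumT.
  by rewrite sumrN subr_ge0.
- have shT N : (fun l => (k l + m N (inl false) l)%N) = shift_on [set: 'I_n] N k.
    by apply/funext => l; rewrite /shift_on inE.
  have shC N j : (fun l => (k l + m N (inr j) l)%N) = shift_on [set~ j] N k.
    by apply/funext => l; rewrite /shift_on !inE /=; case: eqP => //=; rewrite addn0.
  have sh0 N : (fun l => (k l + m N (inl true) l)%N) = k.
    by apply/funext => l; rewrite /= addn0.
  pose p N : K := N.+1%:R.
  have p0 N q : 0 < p N ^+ q by rewrite exprn_gt0.
  have lnDp N A : ln (D (shift_on A N k) / p N ^+ #|A|) =
      ln (D (shift_on A N k)) - ln (p N) *+ #|A|.
    by rewrite ln_div ?posrE// lnXn.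
  rewrite (_ : (fun N => _) = (fun N =>
      - ln (D k) - (n%:R - 1) * ln (D (shift_on [set: 'I_n] N k) / p N ^+ #|[set: 'I_n]|)
      + \sum_j ln (D (shift_on [set~ j] N k) / p N ^+ #|[set~ j]|))); last first.
    apply/funext => N; rewrite big_sumType big_bool/= shT (sh0 0%N).
    under eq_bigr do rewrite shC mulN1r opprK.
    under [in RHS]eq_bigr do rewrite lnDp cardsC1 card_ord.
    rewrite lnDp cardsT card_ord sumrB sumr_const card_ord -mulrnA.
    rewrite -!(mulr_natr (ln (p N))).
    (* Both normalisations contribute [n * (n - 1)] copies of [ln N.+1], with opposite signs, and so
       cancel. *)
    have -> : (n.-1 * n)%:R = (n%:R - 1) * n%:R :> K.
      by case: (n) => [|n']; rewrite ?mulr0//= natrM -natr1 addrK.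
    by ring.
  apply: cvgD.
    apply: cvgB; first exact: cvg_cst.
    apply: cvgM; first exact: cvg_cst.
    rewrite -(malim_setT d k); apply: cvg_ln; last exact: manat_shift_lim.
    by rewrite malim_setT.
  apply: cvg_sumr => j _; rewrite /hfac -malim_setC1.
  apply: cvg_ln; last exact: manat_shift_lim.
  by rewrite malim_setC1; exact: hfac_gt0.
Qed.

Hypothesis hfac_mpos : forall be j, 0 < be -> mpos (fun k => hfac j (k j) `^ (- be)).

(** Exponentiating [mpos_ln_ratio]: the difference is [(expR (be * L k) - 1) * C k], a product of
    two positive functionals. The lower bound factorises over the coordinates, which [D] itself does
    not. *)
Lemma mpos_lower_bound be : 0 < be -> mpos (fun k => D k `^ (- be) -
  dT `^ (be * (n%:R - 1)) * \prod_j hfac j (k j) `^ (- be)).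
Proof.
move=> be0; set L := fun k => - ln (D k) - (n%:R - 1) * ln dT + \sum_j ln (hfac j (k j)).
pose C k := dT `^ (be * (n%:R - 1)) * \prod_j hfac j (k j) `^ (- be).
rewrite (_ : (fun k => _) = fun k => (expR (be * L k) - 1) * C k); last first.
  apply/funext => k; rewrite mulrBl mul1r; congr (_ - _).
  rewrite /C /powR (gt_eqF (D_gt0 k)) (gt_eqF dT_gt0).
  rewrite (eq_bigr (fun j => expR (- be * ln (hfac j (k j))))); last first.
    by move=> j _; rewrite (gt_eqF (hfac_gt0 j (k j))).
  rewrite -expR_sum -!expRD -mulr_sumr /L; congr expR.
  by rewrite !mulrDr; ring.
apply: (@mposM _ _ (fun k => expR (be * L k) - 1) C).
  apply: (@mpos_expR _ _ (fun k => be * L k)).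
  apply: (@mposM _ _ (fun=> be) L); last exact: mpos_ln_ratio.
  by apply: mpos_cst; exact: ltW.
apply: (@mposM _ _ (fun=> _) (fun k => \prod_j hfac j (k j) `^ (- be))).
  by apply: mpos_cst; exact: powR_ge0.
by apply: mpos_prod => j _; exact: hfac_mpos.
Qed.

End infinitely_divisible_determinant.

Lemma is_derive_big (K : realType) (I : finType) (h : I -> K -> K) (x : K) (dh : I -> K) :
  (forall i, is_derive x 1 (h i) (dh i)) ->
  is_derive x 1 (\sum_i h i) (\sum_i dh i).
Proof.
by move=> dhx; elim/big_ind2 : _ => // [|f f' g g' ? ?];
  [exact: is_derive_cst|exact: is_deriveD].
Qed.

(** * Functionals on products of one-variable polynomials *)

Section polynomial_functional.
Context {K : realType} {n : nat}.
Local Notation expo := ('I_n -> nat).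
Implicit Types (q : 'I_n -> {poly K}) (f g : expo -> K) (d : nat).

(* The linear functional u^k |-> f k evaluated at the product of the q_j(u_j). *)
Definition plam d q f : K :=
  \sum_(kk : {ffun 'I_n -> 'I_d}) (\prod_j (q j)`_(kk j)) * f (fun j => kk j).

Lemma plam_prod d q (g : 'I_n -> nat -> K) :
  plam d q (fun k => \prod_j g j (k j)) = \prod_j \sum_(i < d) (q j)`_i * g j i.
Proof.
by rewrite bigA_distr_bigA; apply: eq_bigr => kk _; rewrite big_split.
Qed.

Lemma plam_mono d q (u : 'I_n -> K) : (forall j, size (q j) <= d)%N ->
  plam d q (mono u) = \prod_j (q j).[u j].
Proof.
move=> qd; rewrite (@plam_prod d q (fun j i => u j ^+ i)).
by apply: eq_bigr => j _; rewrite (horner_coef_wide _ (qd j)).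
Qed.

Lemma plam_ge0 d q f : mpos f -> (forall j, size (q j) <= d)%N ->
  (forall j u, 0 <= u <= 1 -> 0 <= (q j).[u]) -> 0 <= plam d q f.
Proof.
move=> pf qd q0; apply: pf => u u01.
rewrite -[X in 0 <= X]/(plam d q (mono u)) plam_mono//.
by apply: prodr_ge0 => j _; exact/q0/u01.
Qed.

Lemma plamB d q f g : plam d q (fun k => f k - g k) = plam d q f - plam d q g.
Proof. by rewrite /plam -sumrB; apply: eq_bigr => kk _; rewrite mulrBr. Qed.

Lemma plamZ d q c f : plam d q (fun k => c * f k) = c * plam d q f.
Proof. by rewrite /plam mulr_sumr; apply: eq_bigr => kk _; rewrite mulrCA. Qed.

Lemma plam_le d q f g : mpos (fun k => g k - f k) -> (forall j, size (q j) <= d)%N ->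
  (forall j u, 0 <= u <= 1 -> 0 <= (q j).[u]) -> plam d q f <= plam d q g.
Proof. by move=> pfg qd q0; rewrite -subr_ge0 -plamB plam_ge0. Qed.

Lemma coefXderiv (p : {poly K}) i : ('X * p^`())`_i = i%:R * p`_i.
Proof.
rewrite coefXM; case: i => [|i] /=; first by rewrite mul0r.
by rewrite coef_deriv mulr_natl.
Qed.

Lemma size_Xderiv (p : {poly K}) : (size ('X * p^`())%R <= size p)%N.
Proof. by apply/leq_sizeP => i pi; rewrite coefXderiv nth_default// mulr0. Qed.

Definition Xderiv_on (S : {set 'I_n}) q : 'I_n -> {poly K} :=
  fun j => if j \in S then 'X * (q j)^`() else q j.

Lemma plam_Xderiv d q f S :
  plam d (Xderiv_on S q) f = plam d q (fun k => (\prod_(j in S) (k j)%:R) * f k).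
Proof.
apply: eq_bigr => kk _; rewrite mulrA; congr (_ * _).
rewrite [X in _ * X]big_mkcond -big_split/=; apply: eq_bigr => j _.
by rewrite /Xderiv_on; case: ifP => _; rewrite ?mulr1// coefXderiv mulrC.
Qed.

Lemma plam_manat d q f (b : {set 'I_n} -> K) :
  plam d q (fun k => manat b k * f k) = \sum_S b S * plam d (Xderiv_on S q) f.
Proof.
under [RHS]eq_bigr do rewrite plam_Xderiv -plamZ /plam.
rewrite exchange_big/=; apply: eq_bigr => kk _.
rewrite -mulr_sumr; congr (_ * _); rewrite /manat /mafun mulr_suml.
by apply: eq_bigr => S _; rewrite mulrA.
Qed.

(* Both evaluated in u = e^-y: test functions that decrease in y. *)
Definition decreasing_test (p : {poly K}) := forall u, 0 <= u <= 1 ->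
  0 <= p.[u] /\ 0 <= ('X * p^`()).[u].

Lemma Xderiv_on_ge0 S q : (forall j, decreasing_test (q j)) ->
  forall j u, 0 <= u <= 1 -> 0 <= (Xderiv_on S q j).[u].
Proof. by move=> tq j u /(tq j)[q0 q1]; rewrite /Xderiv_on; case: ifP. Qed.

Lemma size_Xderiv_on d S q : (forall j, size (q j) <= d)%N ->
  forall j, (size (Xderiv_on S q j) <= d)%N.
Proof.
move=> qd j; rewrite /Xderiv_on; case: ifP => _; last exact: qd.
exact: (leq_trans (size_Xderiv (q j)) (qd j)).
Qed.

Variables (e b : {set 'I_n} -> K) (al : K).
Local Notation D th := (manat (fun S => e S - th * b S)).
Hypothesis al_gt0 : 0 < al.
Hypothesis D_gt0 : forall (th : K) k, 0 <= th <= 1 -> 0 < D th k.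

Let DE th k : D th k = manat e k - th * manat b k.
Proof.
rewrite /manat /mafun mulr_sumr -sumrB; apply: eq_bigr => S _.
by rewrite mulrBl mulrA.
Qed.

(** Differentiation is termwise in a finite sum, and the mean value theorem turns a bound on the
    derivative into one on the increment. The constant [c] serves both monotonicity, with [c = 0],
    and strictness, with [c > 0]. *)
Lemma plam_increment d q (c s t : K) : 0 <= s -> s < t -> t <= 1 ->
  (forall x, s < x < t ->
    c <= \sum_S b S * plam d (Xderiv_on S q) (fun k => D x k `^ (- (al + 1)))) ->
  al * c * (t - s) <= plam d q (fun k => D t k `^ (- al)) - plam d q (fun k => D s k `^ (- al)).
Proof.
move=> s0 st t1 hc.
pose G x := plam d q (fun k => D x k `^ (- al)).
pose dG x := al * \sum_S b S * plam d (Xderiv_on S q) (fun k => D x k `^ (- (al + 1))).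
have dGE (x : K) : 0 <= x <= 1 -> is_derive x 1 G (dG x).
  move=> x01; rewrite /dG.
  have -> : al * \sum_S b S * plam d (Xderiv_on S q) (fun k => D x k `^ (- (al + 1))) =
      \sum_(kk : {ffun 'I_n -> 'I_d}) (\prod_j (q j)`_(kk j)) *:
        (al * (manat b (fun j => kk j) * D x (fun j => kk j) `^ (- (al + 1)))).
    rewrite -plam_manat -plamZ; by [].
  have -> : G = \sum_(kk : {ffun 'I_n -> 'I_d})
      ((\prod_j (q j)`_(kk j)) \*: (fun y : K => D y (fun j => kk j) `^ (- al))).
    by apply/funext => y; rewrite fct_sumE.
  apply: is_derive_big => kk; apply: is_deriveZ.
  set k := fun j => _ : nat.
  have dD : is_derive x 1 (fun y => D y k) (- manat b k).
    rewrite (_ : (fun y => D y k) = cst (manat e k) - (fun y => y * manat b k)); last first.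
      by apply/funext => y; rewrite DE.
    have db : is_derive x 1 (fun y : K => y * manat b k) (manat b k).
      by apply: is_derive_eq; rewrite scaler0 add0r -[_ *: _]/(_ * _) mulr1.
    have dc : is_derive x 1 (cst (manat e k) : K -> K) 0 by exact: is_derive_cst.
    by have := is_deriveB dc db; rewrite sub0r.
  have := @is_derive1_comp _ (fun z => z `^ (- al)) (fun y => D y k) x _ _
    (is_derive1_powR (- al) (D_gt0 k x01)) dD.
  by rewrite (_ : _ * - manat b k = al * (manat b k * D x k `^ (- (al + 1)))) //;
    rewrite opprD; ring.
have [||x] := @MVT _ G dG s t st.
- move=> x; rewrite in_itv/= => /andP[sx xt]; apply: dGE.
  by rewrite (le_trans s0 (ltW sx)) (le_trans (ltW xt) t1).
- apply: continuous_in_subspaceT => x; rewrite inE/= in_itv/= => /andP[sx xt].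
  apply: differentiable_continuous; apply/derivable1_diffP.
  have x01 : 0 <= x <= 1 by rewrite (le_trans s0 sx) (le_trans xt t1).
  exact: (@ex_derive _ _ _ _ _ _ _ (dGE x x01)).
rewrite in_itv/= => sxt ->; rewrite ler_pM2r ?subr_gt0// ler_pM2l//.
exact: hc.
Qed.

End polynomial_functional.

(** * Recovering distribution functions from moments *)

Section test_polynomials.
Context {K : realType}.
Implicit Types (x y u : K) (N : nat).

(** In [u = expR (- y)], the exponent times [u ^+ N.+1] is about [N.+1 * expR (N.+1 * (x - y))].
    This tends to infinity for [y <= x], thanks to the prefactor [N.+1] also at [y = x], and to 0
    for [y > x]. *)
Definition test_exponent x N : nat := (Num.truncn (N.+1%:R * expR (N.+1%:R * x))).+1.

Definition test_poly x N : {poly K} := 1 - (1 - 'X^(N.+1)) ^+ test_exponent x N.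

Lemma horner_test_poly x N u :
  (test_poly x N).[u] = 1 - (1 - u ^+ N.+1) ^+ test_exponent x N.
Proof. by rewrite /test_poly !(hornerE, horner_exp). Qed.

Lemma decreasing_test_poly x N : decreasing_test (test_poly x N).
Proof.
move=> u /andP[u0 u1].
have v0 : 0 <= u ^+ N.+1 by exact: exprn_ge0.
have v1 : 0 <= 1 - u ^+ N.+1 by rewrite subr_ge0 exprn_ile1.
split.
  by rewrite horner_test_poly subr_ge0 exprn_ile1// gerBl.
rewrite /test_poly derivB derivC sub0r deriv_exp derivB derivC sub0r derivXn.
set M := (test_exponent x N).-1.
rewrite !(hornerE, horner_exp, hornerMn) /= mulNr mulNrn opprK.
by rewrite mulr_ge0// mulrn_wge0// mulr_ge0 ?exprn_ge0// mulrn_wge0// exprn_ge0.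
Qed.

Lemma test_poly_le1 x N u : 0 <= u <= 1 -> (test_poly x N).[u] <= 1.
Proof.
move=> /andP[u0 u1]; rewrite horner_test_poly gerBl exprn_ge0// subr_ge0.
exact: exprn_ile1.
Qed.

Lemma test_exponent_ge x N : N.+1%:R * expR (N.+1%:R * x) <= (test_exponent x N)%:R :> K.
Proof. by rewrite ltW// truncnS_gt. Qed.

Lemma test_exponent_le x N : (test_exponent x N)%:R <= N.+1%:R * expR (N.+1%:R * x) + 1 :> K.
Proof.
by rewrite /test_exponent -natr1 lerD2r truncn_le mulr_ge0// expR_ge0.
Qed.

Lemma expRnatM N y : expR (- y) ^+ N.+1 = expR (- (N.+1%:R * y)).
Proof. by rewrite -expRM_natl mulrN. Qed.

Lemma test_poly_ge x N y : 0 <= y -> y <= x ->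
  1 - expR (- N.+1%:R) <= (test_poly x N).[expR (- y)].
Proof.
move=> y0 yx; rewrite horner_test_poly lerD2l lerN2 expRnatM.
set v := expR _; set M := test_exponent x N.
have v1 : v <= 1 by rewrite -expR0 ler_expR oppr_le0 mulr_ge0.
apply: (@le_trans _ _ (expR (- v) ^+ M)).
  by rewrite lerXn2r ?nnegrE ?subr_ge0 ?expR_ge0// expR_ge1Dx.
rewrite -expRM_natl ler_expR mulrN lerN2.
apply: (@le_trans _ _ (N.+1%:R * expR (N.+1%:R * x) * v)); last first.
  by rewrite ler_wpM2r ?expR_ge0// test_exponent_ge.
rewrite -mulrA -expRD -[leLHS]mulr1 ler_wpM2l// -expR0 ler_expR -mulrBr mulr_ge0//.
by rewrite subr_ge0.
Qed.

(** Bernoulli's inequality bounds the test function by the exponent times [v]; the second summand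
    comes from rounding the exponent up. *)
Lemma test_poly_le x N y : 0 <= y ->
  (test_poly x N).[expR (- y)] <=
    N.+1%:R * expR (- (N.+1%:R * (y - x))) + expR (- (N.+1%:R * y)).
Proof.
move=> y0; rewrite horner_test_poly expRnatM.
set v := expR (- _); set M := test_exponent x N.
have v0 : 0 <= v by exact: expR_ge0.
have v1 : v <= 1 by rewrite -expR0 ler_expR oppr_le0 mulr_ge0.
have bern m : 1 - m%:R * v <= (1 - v) ^+ m.
  elim: m => [|m ih]; first by rewrite mul0r subr0 expr0.
  rewrite exprS -natr1; have := ler_wpM2l (_ : 0 <= 1 - v) ih.
  rewrite subr_ge0 => /(_ v1); apply: le_trans.
  have : 0 <= m%:R * (v * v) :> K by rewrite !mulr_ge0.
  by nra.
apply: (@le_trans _ _ (M%:R * v)); first by have := bern M; lra.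
apply: (@le_trans _ _ ((N.+1%:R * expR (N.+1%:R * x) + 1) * v)).
  by rewrite ler_wpM2r// test_exponent_le.
rewrite mulrDl mul1r lerD2r -mulrA -expRD le_eqVlt; apply/orP; left; apply/eqP.
by congr (_ * expR _); ring.
Qed.

Lemma cvg_nat_expRN (z : K) : 0 < z -> N.+1%:R * expR (- (N.+1%:R * z)) @[N --> \oo] --> 0.
Proof.
move=> z0; apply: (@squeeze_cvgr _ _ _ _ (cst 0) (fun N => 2 / z ^+ 2 * N.+1%:R^-1)).
- apply: nearW => N; rewrite mulr_ge0 ?expR_ge0//=.
  have Nz0 : 0 < N.+1%:R * z by rewrite mulr_gt0.
  have := expR_ge1Dxn 1 (ltW Nz0); rewrite /= => h.
  have h2 : (N.+1%:R * z) ^+ 2 / 2 <= expR (N.+1%:R * z) by apply: le_trans h; rewrite lerDr.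
  rewrite expRN ler_pdivrMr ?expR_gt0//.
  apply: (@le_trans _ _ (2 / z ^+ 2 * N.+1%:R^-1 * ((N.+1%:R * z) ^+ 2 / 2))).
    rewrite le_eqVlt; apply/orP; left; apply/eqP.
    by field; rewrite ?pnatr_eq0 ?gt_eqF.
  by rewrite ler_wpM2l// !mulr_ge0 ?invr_ge0 ?exprn_ge0 ?(ltW z0).
- exact: cvg_cst.
- rewrite -[X in _ --> X](mulr0 (2 / z ^+ 2)).
  by apply: cvgM; [exact: cvg_cst|exact: cvg_harmonic].
Qed.

Lemma cvg_expRN_nat (z : K) : 0 < z -> expR (- (N.+1%:R * z)) @[N --> \oo] --> 0.
Proof.
move=> z0; apply: (@squeeze_cvgr _ _ _ _ (cst 0)
    (fun N => N.+1%:R * expR (- (N.+1%:R * z)))).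
- by apply: nearW => N; rewrite expR_ge0/= ler_peMl ?expR_ge0// ler1n.
- exact: cvg_cst.
- exact: cvg_nat_expRN.
Qed.

(** The limit is the closed indicator, correct at [y = x] as well, so no absence of atoms has to be
    known. Positivity of [x] makes [y] positive in the case [x < y]. *)
Lemma cvg_test_poly x y : 0 < x -> 0 <= y ->
  (test_poly x N).[expR (- y)] @[N --> \oo] --> ((y <= x)%R%:R : K).
Proof.
move=> x0 y0; have u01 : 0 <= expR (- y) <= 1.
  by rewrite expR_ge0 -expR0 ler_expR oppr_le0.
have [yx|xy] := leP y x.
- apply: (@squeeze_cvgr _ _ _ _ (fun N => 1 - expR (- N.+1%:R)) (cst 1)).
  + by apply: nearW => N; rewrite test_poly_ge//= test_poly_le1.
  + rewrite -[X in _ --> X]subr0; apply: cvgB; first exact: cvg_cst.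
    by have := cvg_expRN_nat ltr01; under eq_fun do rewrite mulr1.
  + exact: cvg_cst.
- apply: (@squeeze_cvgr _ _ _ _ (cst 0) (fun N =>
    N.+1%:R * expR (- (N.+1%:R * (y - x))) + expR (- (N.+1%:R * y)))).
  + by apply: nearW => N; rewrite test_poly_le//= andbT; case: (decreasing_test_poly x N u01).
  + exact: cvg_cst.
  + rewrite -[X in _ --> X]addr0; apply: cvgD.
      by apply: cvg_nat_expRN; rewrite subr_gt0.
    by apply: cvg_expRN_nat; exact: lt_trans xy.
Qed.

End test_polynomials.

(** * Moments and distribution function of a nonnegative random vector *)

Section laws_on_the_orthant.
Context {K : realType} {n : nat} d (T : measurableType d).
Local Notation expo := ('I_n -> nat).
Variables (mu : {measure set T -> \bar K}) (Y : 'I_n -> T -> K) (f : expo -> K).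
Local Notation T0 := [set y | forall j, 0 <= Y j y].
Hypothesis muT : mu [set: T] = 1%E.
Hypothesis mY : forall j, measurable_fun [set: T] (Y j).
Hypothesis muT0 : mu T0 = 1%E.
Hypothesis fE : forall k : expo,
  (\int[mu]_y (expR (- \sum_j (k j)%:R * Y j y))%:E = (f k)%:E)%E.

Let m_forall (P : 'I_n -> set K) : (forall j, measurable (P j)) ->
  measurable [set y | forall j, P j (Y j y)].
Proof.
move=> mP; rewrite (_ : mkset _ = \bigcap_(j in [set: 'I_n]) (setT `&` Y j @^-1` P j)).
  by apply: fin_bigcap_measurable => // j _; exact: mY.
by apply/seteqP; split => [y /= h j _|y h j]; [split => //; exact: h|case: (h j I)].
Qed.

Let mT0 : measurable T0.
Proof.
apply: (m_forall (P := fun=> [set y | 0 <= y])) => j.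
rewrite (_ : mkset _ = `[0, +oo[%classic) //.
by apply/seteqP; split => y /=; rewrite in_itv/= andbT.
Qed.

Let integral_orthant (h : T -> \bar K) : measurable_fun [set: T] h ->
  (forall y, 0 <= h y)%E -> (\int[mu]_y h y = \int[mu]_(y in T0) h y)%E.
Proof.
move=> mh h0; rewrite (@ge0_negligible_integral _ _ _ mu setT (~` T0))//.
- by rewrite setTD setCK.
- exact: measurableC.
- have muTy : (mu [set: T] < +oo)%E by rewrite muT ltry.
  rewrite -setTD; apply: etrans (measureD measurableT mT0 muTy) _; rewrite setTI.
  by apply: etrans (congr2 (fun a b => a - b)%E muT muT0) _; rewrite subee.
Qed.

Let U y j := expR (- Y j y).

Let cubeU y : T0 y -> cube (U y).
Proof. by move=> y0 j; rewrite expR_ge0 -expR0 ler_expR oppr_le0; exact: y0. Qed.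

Let mU D j : measurable_fun D (fun y => U y j).
Proof.
apply: measurable_funTS; apply: measurableT_comp; first exact: measurable_expR.
exact: measurableT_comp.
Qed.

Let monoU y k : mono (U y) k = expR (- \sum_j (k j)%:R * Y j y).
Proof.
rewrite -sumrN expR_sum; apply: eq_bigr => j _.
by rewrite /U -expRM_natl mulrN.
Qed.

Let m_mono D k : measurable_fun D (fun y => mono (U y) k).
Proof.
by apply: measurable_prod => j _; apply: measurable_funX; exact: mU.
Qed.

Let integral_mono k : (\int[mu]_(y in T0) (mono (U y) k)%:E = (f k)%:E)%E.
Proof.
rewrite -fE integral_orthant.
- by apply: eq_integral => y _; rewrite monoU.
- by under eq_fun do rewrite -monoU; apply/measurable_EFinP; exact: m_mono.
- by move=> y; rewrite lee_fin expR_ge0.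
Qed.

Let integrable_mono k : mu.-integrable T0 (fun y => (mono (U y) k)%:E).
Proof.
apply/integrableP; split; first by apply/measurable_EFinP; exact: m_mono.
under eq_integral => y.
  rewrite inE => y0; rewrite gee0_abs ?lee_fin ?mono_ge0//; last exact: cubeU.
  over.
by rewrite integral_mono ltry.
Qed.

Let integral_comb (I : finType) (a : I -> K) (k : I -> expo) :
  (\int[mu]_(y in T0) (\sum_i a i * mono (U y) (k i))%:E = (\sum_i a i * f (k i))%:E)%E.
Proof.
under eq_integral do rewrite -sumEFin.
rewrite integral_sum//; last by move=> i; exact: (integrableZl mT0 _ (integrable_mono (k i))).
rewrite -sumEFin; apply: eq_bigr => i _; rewrite EFinM -integral_mono.
under eq_integral do rewrite EFinM.
by rewrite integralZl//; exact: integrable_mono.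
Qed.

Lemma mpos_law : mpos f.
Proof.
move=> I a k h; rewrite -lee_fin -integral_comb; apply: integral_ge0 => y y0.
by rewrite lee_fin; apply: h; exact: cubeU.
Qed.

Lemma measurable_lower_orthant (x : 'I_n -> K) :
  measurable [set y | forall j, Y j y <= x j].
Proof.
apply: (m_forall (P := fun j => [set y | y <= x j])) => j.
by rewrite (_ : mkset _ = `]-oo, x j]%classic).
Qed.

(** [plam] integrates the product of test functions, which is bounded by 1 on the orthant and
    converges to the indicator of the event; dominated convergence applies. Hence [p] depends on the
    law only through [f]. *)
Lemma cvg_plam_law (m : nat -> nat) (x : 'I_n -> K) (p : K) :
  (forall N j, (size (test_poly (x j) N) <= m N)%N) -> (forall j, 0 < x j) ->
  p%:E = mu [set y | forall j, Y j y <= x j] ->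
  plam (m N) (fun j => test_poly (x j) N) f
    @[N --> \oo] --> p.
Proof.
move=> xm x0 pE; set B := [set y | _] in pE.
have mB : measurable B by exact: measurable_lower_orthant.
pose g N y := \prod_j (test_poly (x j) N).[U y j].
have plamE N : (\int[mu]_(y in T0) (g N y)%:E =
    (plam (m N) (fun j => test_poly (x j) N) f)%:E)%E.
  rewrite -integral_comb; apply: eq_integral => y _; congr (_%:E).
  by rewrite /g -(@plam_mono _ _ (m N)).
have pB : (p%:E = \int[mu]_(y in T0) (\prod_j ((Y j y <= x j)%R%:R : K))%:E)%E.
  rewrite pE -(setIT B) -integral_indic// integral_orthant//; last first.
    by apply/measurable_EFinP.
  apply: eq_integral => y _; rewrite indicE; congr (_%:E).
  have [yB|yB] := boolP (y \in B).
    by rewrite big1// => j _; move: yB; rewrite inE => /(_ j) ->.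
  move: yB; rewrite notin_setE => /existsNP[j /negP yj].
  by rewrite (bigD1 j)//= (negbTE yj) mul0r.
have : (\int[mu]_(y in T0) (g N y)%:E)%E @[N --> \oo] --> p%:E.
  rewrite pB; apply: (@dominated_cvg _ _ _ mu T0 mT0 _ _ (cst 1%E)) => //.
  - move=> N; apply/measurable_EFinP; apply: measurable_prod => j _.
    apply: (measurableT_comp (f := horner (test_poly (x j) N))); last exact: mU.
    apply: continuous_measurable_fun; exact: continuous_horner.
  - move=> y y0; apply: cvg_EFin; first by apply: nearW.
    apply: cvg_prodr => j _; apply: cvg_test_poly => //; exact: y0.
  - apply/integrableP; split; first exact: measurable_cst.
    under eq_integral do rewrite /= normr1.
    by rewrite integral_cst// mul1e (le_lt_trans _ (ltry 1))// muT0.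
  - move=> N y y0; rewrite lee_fin ger0_norm.
      apply: prodr_ile1 => j _; have [] := decreasing_test_poly (x j) N (cubeU y0 j).
      by move=> -> _; rewrite test_poly_le1//; exact: (cubeU y0 j).
    apply: prodr_ge0 => j _.
    by have [] := decreasing_test_poly (x j) N (cubeU y0 j).
under eq_cvg do rewrite plamE.
by move=> /fine_cvgP[].
Qed.

End laws_on_the_orthant.

(** * Lower bounds for one-dimensional gamma test integrals *)

Section gamma_lower_bounds.
Context {K : realType}.
Local Notation leb := (@lebesgue_measure K).

Lemma mpos_gamma_coord n (h0 h1 be : K) (j : 'I_n) : 0 < h0 -> 0 < h1 -> 0 < be ->
  mpos (fun k : 'I_n -> nat => (h0 + h1 * (k j)%:R) `^ (- be)).
Proof.
move=> h00 h10 be0; pose s := h1 / h0; have s0 : 0 < s by rewrite divr_gt0.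
have sk k : 0 <= s * k%:R by rewrite mulr_ge0// ltW.
rewrite (_ : (fun k => _) = fun k : 'I_n -> nat =>
    h0 `^ (- be) * (1 + s * (k j)%:R) `^ (- be)); last first.
  apply/funext => k; rewrite -powRM ?(ltW h00) ?addr_ge0//; congr (_ `^ _).
  by rewrite mulrDr mulr1 mulrA /s mulrCA divff ?gt_eqF// mulr1.
apply: (@mposM _ _ (fun=> _) (fun k : 'I_n -> nat => (1 + s * (k j)%:R) `^ (- be))).
  by apply: mpos_cst; exact: powR_ge0.
(* After extracting [h0], the function is the transform of a vector supported on the [j]-th axis,
   with a gamma coordinate scaled by [h1 / h0]. *)
pose Y l (y : K) := if l == j then s * y else 0.
apply: (@mpos_law _ _ _ _ (gamma_law be) Y).
- exact: gamma_lawT.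
- move=> l; rewrite /Y; case: (l == j); last exact: measurable_cst.
  exact: measurable_funM.
- rewrite -(gamma_law_ge0_set be0); congr (gamma_law be _).
  apply/seteqP; split => y /= y0.
    by have := y0 j; rewrite /Y eqxx pmulr_rge0.
  by move=> l; rewrite /Y; case: eqP => // _; rewrite mulr_ge0// ltW.
- move=> k; rewrite -(laplace_gamma_law be0 (sk (k j))).
  apply: eq_integral => y _; congr (expR (- _))%:E.
  rewrite (bigD1 j)//= /Y eqxx big1 ?addr0; last by move=> l /negbTE ->; rewrite mulr0.
  by ring.
Qed.

Lemma integral_poly_gamma (c be : K) (p : {poly K}) d : 0 < c -> 0 < be -> (size p <= d)%N ->
  (\int[leb]_(y in `[0%R, +oo[) (p.[expR (- y)] * (expR (- (c * y)) * y `^ (be - 1)))%:E =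
   (GammaFun be * \sum_(i < d) p`_i * (c + i%:R) `^ (- be))%:E)%E.
Proof.
move=> c0 be0 pd.
have ci0 (i : nat) : 0 < c + i%:R by rewrite ltr_wpDr.
pose e (i : nat) (y : K) := expR (- ((c + i%:R) * y)) * y `^ (be - 1).
have me i D : measurable_fun D (fun y => (e i y)%:E).
  apply/measurable_EFinP; apply: measurable_funTS; apply: measurable_funM.
    apply: measurableT_comp; first exact: measurable_expR.
    by apply: measurableT_comp => //; exact: measurable_funM.
  exact: measurable_powR.
have ie i : leb.-integrable `[0%R, +oo[ (fun y => (e i y)%:E).
  apply/integrableP; split; first exact: me.
  under eq_integral do rewrite gee0_abs ?lee_fin ?mulr_ge0 ?expR_ge0 ?powR_ge0//.
  by rewrite integral_gamma_ker_scale// ltry.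
transitivity (\int[leb]_(y in `[0%R, +oo[) (\sum_(i < d) (p`_i)%:E * (e i y)%:E))%E.
  apply: eq_integral => y _; rewrite (horner_coef_wide _ pd) mulr_suml -sumEFin.
  apply: eq_bigr => i _; rewrite -EFinM -mulrA mulrA -mulrA; congr (_ * _)%:E.
  rewrite /e mulrA; congr (_ * _); rewrite -expRM_natl -expRD; congr expR.
  by ring.
rewrite integral_sum//; last by move=> i; exact: integrableZl (ie i).
rewrite mulr_sumr -sumEFin; apply: eq_bigr => i _.
by rewrite integralZl// integral_gamma_ker_scale// -EFinM; congr (_%:E); ring.
Qed.

Let measurable_horner_expRN (p : {poly K}) D : measurable_fun D (fun y : K => p.[expR (- y)]).
Proof.
apply: measurable_funTS; apply: (measurableT_comp (f := horner p)).
  by apply: continuous_measurable_fun; exact: continuous_horner.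
apply: measurableT_comp; first exact: measurable_expR.
exact: measurable_funN.
Qed.

Let expRN01 (y : K) : 0 <= y -> 0 <= expR (- y) <= 1.
Proof. by move=> y0; rewrite expR_ge0 -expR0 ler_expR oppr_le0. Qed.

Let half_le_test_poly (x y : K) N : 0 <= y -> y <= x -> 2^-1 <= (test_poly x N).[expR (- y)].
Proof.
move=> y0 yx; apply: le_trans (test_poly_ge N y0 yx).
have e1 : expR (- N.+1%:R) <= 2^-1 :> K.
  rewrite expRN lef_pV2 ?posrE ?expR_gt0//; apply: le_trans (expR_ge1Dx _).
  by rewrite -[X in X <= _]natr1 addrC lerD2l ler1n.
by lra.
Qed.

Lemma integral_test_poly_ge (x : K) N : 0 < x ->
  ((x / 4)%:E <= \int[leb]_(y in `[(x / 2)%R, (2 * x)%R]) ((test_poly x N).[expR (- y)])%:E)%E.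
Proof.
move=> x0.
have m : measurable_fun [set: K] (fun y : K => ((test_poly x N).[expR (- y)])%:E).
  by apply/measurable_EFinP; exact: measurable_horner_expRN.
apply: (@le_trans _ _ (\int[leb]_(y in `[(x / 2)%R, x]) ((test_poly x N).[expR (- y)])%:E)%E).
  apply: (@le_trans _ _ (\int[leb]_(y in `[(x / 2)%R, x]) (2^-1)%:E)%E).
    rewrite integral_cst//= lebesgue_measure_itv/= lte_fin ifT; last by lra.
    by rewrite -EFinB -EFinM lee_fin; lra.
  apply: ge0_le_integral => //.
  - exact: measurable_funTS.
  - move=> y; rewrite /= in_itv/= => /andP[y1 y2]; rewrite lee_fin.
    by apply: half_le_test_poly => //; lra.
apply: ge0_subset_integral => //.
- exact: measurable_funTS.
- move=> y; rewrite /= in_itv/= => /andP[y1 y2]; rewrite lee_fin.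
  have y0 : 0 <= y by lra.
  by have [] := decreasing_test_poly x N (expRN01 y0).
- by move=> y; rewrite /= !in_itv/= => /andP[y1 y2]; apply/andP; split => //; lra.
Qed.

(** [y |-> - p.[expR (- y)]] is a primitive of the integrand. The interval straddles [x], so this
    drop stays away from 0 for large [N]. *)
Lemma integral_Xderiv_test_poly (x : K) N : 0 < x ->
  (\int[leb]_(y in `[(x / 2)%R, (2 * x)%R]) (('X * (test_poly x N)^`()).[expR (- y)])%:E =
   ((test_poly x N).[expR (- (x / 2))] - (test_poly x N).[expR (- (2 * x))])%:E)%E.
Proof.
move=> x0; set p := test_poly x N.
have -> : (p.[expR (- (x / 2))] - p.[expR (- (2 * x))])%:E =
  ((fun y => - p.[expR (- y)]) (2 * x) - (fun y => - p.[expR (- y)]) (x / 2))%:E.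
  by rewrite /= opprK addrC.
apply: (@integral_is_derive K (fun y => - p.[expR (- y)])); first by lra.
- move=> y _.
  have de : is_derive y 1 (fun y : K => expR (- y)) (- expR (- y)).
    have dn : is_derive y 1 (fun y : K => - y) (- 1) by exact: is_deriveN.
    have := @is_derive1_comp _ expR (fun y => - y) y _ _ (is_derive_expR (- y)) dn.
    by rewrite mulrN1.
  have := is_deriveN (@is_derive1_comp _ (horner p) (fun y => expR (- y)) y _ _
    (is_derive_poly p _) de).
  by rewrite hornerM hornerX mulrN opprK mulrC.
- move=> y _; apply: continuous_comp; last exact: continuous_horner.
  apply: continuous_comp; [exact: continuousN|exact: continuous_expR].
Qed.

(** Scaling by [h1] makes the sum a gamma integral of the test function, or of its derivative, and
    restricting it to [x/2, 2x] keeps a fixed share. The bound [kappa] depends only on the ranges of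
    [h0] and [h1], not on [N] or [d]. *)
Lemma gamma_test_lower (x be H r0 r1 : K) : 0 < x -> 1 <= be -> 0 < r0 -> 0 < r1 ->
  exists2 kappa, 0 < kappa & \forall N \near \oo, forall (h0 h1 : K) (b : bool) d,
    0 < h0 <= H -> r0 <= h1 <= r1 -> (size (test_poly x N) <= d)%N ->
    kappa <= \sum_(i < d) (if b then 'X * (test_poly x N)^`() else test_poly x N)`_i *
      (h0 + h1 * i%:R) `^ (- be).
Proof.
move=> x0 be1 r00 r10; have be0 : 0 < be := lt_le_trans ltr01 be1.
have G0 := GammaFun_gt0 be0.
pose w0 : K := expR (- (H / r0 * (2 * x))) * (x / 2) `^ (be - 1).
have w00 : 0 < w0 by rewrite mulr_gt0 ?expR_gt0// powR_gt0// divr_gt0.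
(* For the test function itself, the value 1/2 over [x/2, x] gives x/4; for its derivative, the drop
   from at least 1/2 to at most 1/4 gives 1/4. *)
pose m0 : K := Num.min (x / 4) 4^-1.
have m00 : 0 < m0 by rewrite lt_min divr_gt0//=.
exists (r1 `^ (- be) * ((GammaFun be)^-1 * (w0 * m0))).
  by apply: mulr_gt0; [exact: powR_gt0|apply: mulr_gt0; [rewrite invr_gt0|apply: mulr_gt0]].
have x20 : 0 <= 2 * x by lra.
have c2 := cvg_test_poly x0 x20.
have {}c2 : \forall N \near \oo, (test_poly x N).[expR (- (2 * x))] <= 4^-1.
  move: c2; have -> : (2 * x <= x) = false by apply/negbTE; rewrite -ltNge; lra.
  move=> /cvgrPdist_le/(_ 4^-1); rewrite invr_gt0 ltr0n => /(_ isT); apply: filterS => N.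
  by rewrite sub0r normrN => /(le_trans (ler_norm _)).
near=> N => h0 h1 b d /andP[h00 h0H] /andP[r0h1 h1r1] pd.
have pN2 : (test_poly x N).[expR (- (2 * x))] <= 4^-1 by near: N.
have h10 : 0 < h1 := lt_le_trans r00 r0h1.
set q := if b then _ else _.
have qd : (size q <= d)%N.
  by rewrite /q; case: (b) => //; exact: leq_trans (size_Xderiv _) pd.
pose c := h0 / h1; have c0 : 0 < c by rewrite divr_gt0.
have cH : c <= H / r0.
  by rewrite ler_pdivlMr// (le_trans _ h0H)// /c mulrAC ler_pdivrMr// ler_wpM2l// ltW.
have -> : \sum_(i < d) q`_i * (h0 + h1 * i%:R) `^ (- be) =
    h1 `^ (- be) * \sum_(i < d) q`_i * (c + i%:R) `^ (- be).
  rewrite mulr_sumr; apply: eq_bigr => i _; rewrite mulrCA -powRM ?addr_ge0 ?(ltW c0) ?(ltW h10)//.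
  by congr (_ * _ `^ _); rewrite /c; field; rewrite gt_eqF.
have q0 u : 0 <= u <= 1 -> 0 <= q.[u].
  by move=> /(decreasing_test_poly x N)[? ?]; rewrite /q; case: (b).
have S0 : (GammaFun be)^-1 * (w0 * m0) <= \sum_(i < d) q`_i * (c + i%:R) `^ (- be).
  rewrite ler_pdivrMl// -lee_fin -integral_poly_gamma//.
  have mi D : measurable_fun D (fun y : K =>
      (q.[expR (- y)] * (expR (- (c * y)) * y `^ (be - 1)))%:E).
    apply/measurable_EFinP; apply: measurable_funM; first exact: measurable_horner_expRN.
    apply: measurable_funTS; apply: measurable_funM; last exact: measurable_powR.
    apply: measurableT_comp; first exact: measurable_expR.
    by apply: measurableT_comp => //; exact: measurable_funM.
  apply: (@le_trans _ _ (\int[leb]_(y in `[(x / 2)%R, (2 * x)%R])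
      (q.[expR (- y)] * (expR (- (c * y)) * y `^ (be - 1)))%:E)%E); last first.
    apply: ge0_subset_integral => //; first exact: mi.
      move=> y; rewrite /= in_itv/= andbT => y0.
      by rewrite lee_fin !mulr_ge0 ?expR_ge0 ?powR_ge0// q0// expRN01.
    by move=> y; rewrite /= !in_itv/= andbT => /andP[y1 _]; lra.
  apply: (@le_trans _ _ (\int[leb]_(y in `[(x / 2)%R, (2 * x)%R])
      (w0%:E * (q.[expR (- y)])%:E))%E); last first.
    apply: ge0_le_integral => //.
    - move=> y; rewrite /= in_itv/= => /andP[y1 y2].
      by rewrite -EFinM lee_fin mulr_ge0 ?(ltW w00)// q0// expRN01//; lra.
    - by apply/measurable_EFinP; apply: measurable_funM => //; exact: measurable_horner_expRN.
    - exact: mi.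
    - move=> y; rewrite /= in_itv/= => /andP[y1 y2].
      have y0 : 0 <= y by lra.
      rewrite -EFinM lee_fin mulrC ler_wpM2l ?q0 ?expRN01//.
      rewrite ler_pM ?expR_ge0 ?powR_ge0// ?ler_expR ?lerN2.
        by rewrite ler_pM// ltW.
      by rewrite ge0_ler_powR ?nnegrE ?subr_ge0//; lra.
  rewrite ge0_integralZl//; last 3 first.
  - by apply/measurable_EFinP; exact: measurable_horner_expRN.
  - move=> y; rewrite /= in_itv/= => /andP[y1 y2].
    by rewrite lee_fin q0// expRN01//; lra.
  - by rewrite lee_fin ltW.
  rewrite EFinM lee_wpmul2l ?lee_fin ?(ltW w00)//.
  rewrite /q /m0; case: (b).
    rewrite integral_Xderiv_test_poly// lee_fin ge_min; apply/orP; right.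
    have := @half_le_test_poly x (x / 2) N; rewrite divr_ge0 ?(ltW x0)// => /(_ isT).
    by rewrite ler_pdivrMr// => h; have := h _; lra.
  by apply: le_trans (integral_test_poly_ge N x0); rewrite lee_fin ge_min lexx.
have S1 : 0 <= (GammaFun be)^-1 * (w0 * m0).
  by apply: mulr_ge0; [rewrite invr_ge0; exact: ltW|apply: mulr_ge0; exact: ltW].
have hr : r1 `^ (- be) <= h1 `^ (- be).
  rewrite !powRN lef_pV2 ?posrE ?powR_gt0//.
  by apply: ge0_ler_powR; rewrite ?nnegrE ?(ltW h10) ?(ltW r10) ?(ltW be0).
exact: (ler_pM (powR_ge0 _ _) S1 hr S0).
Unshelve. all: by end_near. Qed.

End gamma_lower_bounds.

(** * Damped correlation matrices *)

Section positive_definite.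
Context {K : realType}.

Lemma quad_sum n (u : 'cV[K]_n) : (u^T *m u) 0 0 = \sum_i u i 0 ^+ 2.
Proof. by rewrite mxE; apply: eq_bigr => i _; rewrite mxE expr2. Qed.

Lemma quad_eq0 n (u : 'cV[K]_n) : (u^T *m u) 0 0 = 0 -> u = 0.
Proof.
rewrite quad_sum => /eqP; rewrite psumr_eq0; last by move=> i _; exact: sqr_ge0.
move=> /allP h; apply/matrixP => i j; rewrite !ord1 mxE.
by have := h i (mem_index_enum _); rewrite sqrf_eq0 => /eqP.
Qed.

Lemma psd_kernel n (A : 'M[K]_n) (u : 'cV[K]_n) : A^T = A -> positive_semidefinite A ->
  (u^T *m A *m u) 0 0 = 0 -> A *m u = 0.
Proof.
move=> At pA uAu; apply: quad_eq0; set w := A *m u; set c := _ 0 0.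
pose e := (w^T *m A *m w) 0 0.
have e0 : 0 <= e by exact: pA.
have c0 : 0 <= c by rewrite /c quad_sum sumr_ge0// => i _; exact: sqr_ge0.
(* A small step from [u] against [w = A u], where the form is [2 * s * c + s ^+ 2 * e]; it makes the
   form negative unless [c = 0]. The denominator [1 + e] is positive even when [e = 0]. *)
pose s := - c / (1 + e).
have := pA (u + s *: w).
have -> : ((u + s *: w)^T *m A *m (u + s *: w)) 0 0 = 2 * s * c + s ^+ 2 * e.
  have -> : (u + s *: w)^T *m A *m (u + s *: w) =
      u^T *m A *m u + s *: (w^T *m w) + s *: (w^T *m w) + s ^+ 2 *: (w^T *m A *m w).
    have uA : u^T *m A = w^T by rewrite /w trmx_mul At.
    have -> : (u + s *: w)^T = u^T + s *: w^T by rewrite linearD/= linearZ.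
    rewrite !mulmxDl !mulmxDr uA -!scalemxAl -!scalemxAr -!mulmxA -/w.
    by rewrite scalerA -expr2 addrA.
  move: uAu; rewrite /c /e.
  move: (u^T *m A *m u) (w^T *m w) (w^T *m A *m w) => X Y Z X0.
  by rewrite !mxE X0; ring.
have d0 : 0 < 1 + e by rewrite ltr_wpDr.
have -> : 2 * s * c + s ^+ 2 * e = - (c ^+ 2 * (2 + e)) / (1 + e) ^+ 2.
  by rewrite /s; field; rewrite gt_eqF.
rewrite ler_pdivlMr ?exprn_gt0// mul0r oppr_ge0 => h.
have : c ^+ 2 * 2 <= c ^+ 2 * (2 + e) by rewrite ler_wpM2l ?sqr_ge0// lerDl.
move=> /le_trans/(_ h); rewrite pmulr_lle0// => c2.
by apply/eqP; rewrite -sqrf_eq0 eq_le c2 sqr_ge0.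
Qed.

Lemma pd_of_nonsingular n (A : 'M[K]_n) (u : 'cV[K]_n) : A^T = A -> positive_semidefinite A ->
  A \in unitmx -> (u^T *m A *m u) 0 0 = 0 -> u = 0.
Proof.
by move=> At pA uA /(psd_kernel At pA) Au; rewrite -[u](mulKmx uA) Au mulmx0.
Qed.

Lemma unitmx_of_pd n (A : 'M[K]_n) : (forall u : 'cV[K]_n, (u^T *m A *m u) 0 0 = 0 -> u = 0) ->
  A \in unitmx.
Proof.
move=> pd; rewrite unitmxE unitfE; apply/det0P => -[v v0 vA].
move: v0; rewrite -[v]trmxK [v^T]pd ?trmx0 ?eqxx// trmxK vA mul0mx.
by rewrite mxE.
Qed.

(** Along [s |-> 1 + s A T] the determinant starts at 1 and never vanishes: a left kernel vector [v]
    would give [v A v^T = - s \sum_j t_j (v A)_j ^ 2], so every term vanishes and then so does [v].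
    The intermediate value theorem concludes. *)
Lemma det_laplace_gt0 n (A : 'M[K]_n) (t : 'rV[K]_n) : positive_semidefinite A ->
  (forall j, 0 <= t 0 j) -> 0 < \det (1%:M + A *m diag_mx t).
Proof.
move=> pA t0.
pose p : {poly K} := \det (1%:M + 'X *: map_mx polyC (A *m diag_mx t)).
have pE s : p.[s] = \det (1%:M + s *: (A *m diag_mx t)).
  rewrite -horner_evalE -det_map_mx; congr (\det _); apply/matrixP => i j.
  by rewrite !mxE /= horner_evalE hornerD hornerM hornerX hornerC; case: eqP => _; rewrite ?hornerC.
have nz s : 0 <= s -> p.[s] != 0.
  move=> s0; rewrite pE; apply/det0P => -[v v0].
  rewrite mulmxDr mulmx1 -scalemxAr mulmxA => /eqP; rewrite addr_eq0 => /eqP vE.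
  have vj j : v 0 j = - (s * ((v *m A) 0 j * t 0 j)).
    by rewrite {1}vE mul_mx_diag !mxE.
  have := pA v^T; rewrite trmxK mxE.
  under eq_bigr do rewrite [v^T _ _]mxE vj mulrN.
  rewrite sumrN oppr_ge0 => h.
  have wt j : s * (t 0 j * (v *m A) 0 j ^+ 2) = 0.
    have h0 i : 0 <= s * (t 0 i * (v *m A) 0 i ^+ 2) by rewrite mulr_ge0// mulr_ge0// sqr_ge0.
    have : \sum_i s * (t 0 i * (v *m A) 0 i ^+ 2) == 0.
      rewrite eq_le sumr_ge0// andbT; apply: le_trans h.
      by rewrite le_eqVlt; apply/orP; left; apply/eqP; apply: eq_bigr => i _; ring.
    by rewrite psumr_eq0// => /allP/(_ j (mem_index_enum _))/eqP.
  case/eqP: v0; apply/matrixP => i j; rewrite !ord1 [RHS]mxE vj.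
  have /eqP := wt j; rewrite mulf_eq0 mulf_eq0 sqrf_eq0 => /or3P[] /eqP ->; ring.
rewrite ltNge; apply/negP => p1.
have p0 : p.[0] = 1 by rewrite pE scale0r addr0 det1.
have pD : p.[1] = \det (1%:M + A *m diag_mx t) by rewrite pE scale1r.
have [||x x01] := @poly_ivt K (- p) 0 1; first exact: ler01.
  by rewrite !hornerN p0 oppr_le0 ler01 oppr_ge0 pD.
by rewrite rootN; apply/negP; rewrite rootE nz//; case/andP: x01.
Qed.

End positive_definite.

Definition upd {I : eqType} {A : Type} (f : I -> A) (i : I) (x : A) : I -> A :=
  fun k => if k == i then x else f k.

(** * Leibniz expansion of the damped determinant *)

Section damped_determinant.
Context {K : realType} {n : nat}.
Variable R : 'M[K]_n.
Hypothesis R1 : forall i, R i i = 1.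
Implicit Types (th t : 'I_n -> K) (i : 'I_n) (S : {set 'I_n}).

(* [|I + R_tau T|] for [th k = tau_k ^ 2]: the Leibniz sum, where each
   permutation brings every [tau_k] in twice. *)
Definition gdet th t : K := \sum_(s : 'S_n) (-1) ^+ s *
  \prod_k (if s k == k then 1 + t k else th k * (t k * R (s k) k)).

(** The principal minor on [S] of the damped matrix, for [th k = tau_k ^ 2]: permutations moving a
    point off [S] contribute 0. *)
Definition gcoef th S : K := \sum_(s : 'S_n) (-1) ^+ s *
  \prod_k (if k \in S then (if s k == k then 1 else th k * R (s k) k)
           else (s k == k)%:R).

Lemma gdet_mafun th t : gdet th t = mafun (gcoef th) t.
Proof.
rewrite /mafun; under [RHS]eq_bigr do rewrite mulr_suml.
rewrite exchange_big/=; apply: eq_bigr => s _.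
under [RHS]eq_bigr do rewrite -mulrA.
rewrite -mulr_sumr; congr (_ * _).
rewrite (eq_bigr (fun k => (t k * if s k == k then 1 else th k * R (s k) k) +
  (s k == k)%:R)); last first.
  by move=> k _; case: eqP => _; rewrite ?mulr1 ?addr0 1?addrC// mulrCA.
rewrite bigA_distr/=; apply: eq_bigr => S _.
rewrite [X in _ * X]big_mkcond -big_split/=; apply: eq_bigr => k _.
by case: ifP => _; rewrite ?mulr1// mulrC.
Qed.

Lemma det_damped (a t tau : 'rV[K]_n) :
  \det (diag_mx a + damped_mx R tau *m diag_mx t) =
  \sum_(s : 'S_n) (-1) ^+ s * \prod_k (if s k == k then a 0 k + t 0 k
     else tau 0 k ^+ 2 * (t 0 k * R (s k) k)).
Proof.
rewrite mul_mx_diag -det_tr; apply: eq_bigr => s _; congr (_ * _).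
(* [tau_(s k)] is a factor only when [k] is moved, equivalently when [s k] is moved; reindexing
   along [s] turns the product of these factors into that of the [tau_k]. *)
pose g k := if s k == k then 1 else tau 0 k.
transitivity (\prod_k ((if s k == k then a 0 k + t 0 k else t 0 k * R (s k) k) *
    g (s k) * g k)).
  apply: eq_bigr => k _; rewrite !mxE /g (inj_eq perm_inj).
  case: eqP => [->|sk].
    rewrite !mulr1n R1; ring.
  by rewrite ?mulr0n; ring.
rewrite 2!big_split/=.
have -> : \prod_k g (s k) = \prod_k g k by rewrite [RHS](reindex_inj (@perm_inj _ s)).
rewrite -!big_split/=; apply: eq_bigr => k _; rewrite /g.
by case: eqP => _; ring.
Qed.

Lemma gdetE (t tau : 'rV[K]_n) :
  \det (1%:M + damped_mx R tau *m diag_mx t) = gdet (fun k => tau 0 k ^+ 2) (fun k => t 0 k).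
Proof.
have -> : 1%:M = diag_mx (const_mx 1) :> 'M[K]_n by rewrite diag_const_mx.
by rewrite det_damped; apply: eq_bigr => s _; under eq_bigr do rewrite mxE.
Qed.

Lemma gcoef_setT (tau : 'rV[K]_n) :
  gcoef (fun k => tau 0 k ^+ 2) [set: 'I_n]%SET = \det (damped_mx R tau).
Proof.
have -> : damped_mx R tau = diag_mx 0 + damped_mx R tau *m diag_mx (const_mx 1).
  have -> : diag_mx (const_mx 1) = 1%:M :> 'M[K]_n by rewrite diag_const_mx.
  by rewrite mulmx1 linear0 add0r.
rewrite det_damped; apply: eq_bigr => s _; congr (_ * _); apply: eq_bigr => k _.
by rewrite inE !mxE add0r mul1r.
Qed.

(** Each Leibniz product has a single factor involving index [i], and [1 + (1 - x) * t i] times that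
    factor at the modified argument gives the damped one. The argument is the one produced by
    [laplace_damp]. *)
Lemma gdet_damp th t i x : th i = 1 -> 1 + (1 - x) * t i != 0 ->
  gdet (upd th i x) t =
  (1 + (1 - x) * t i) * gdet th (upd t i (x * t i / (1 + (1 - x) * t i))).
Proof.
move=> thi d0; rewrite /gdet mulr_sumr; apply: eq_bigr => s _.
rewrite mulrCA; congr (_ * _); rewrite [LHS](bigD1 i)//= [in RHS](bigD1 i)//= [RHS]mulrA.
congr (_ * _); last first.
  by apply: eq_bigr => k /negbTE ki; rewrite /upd ki.
by rewrite /upd eqxx thi; case: eqP => _; field.
Qed.

Lemma gdet_upd0 th t i : gdet (upd th i 0) t = (1 + t i) * gdet th (upd t i 0).
Proof.
rewrite /gdet mulr_sumr; apply: eq_bigr => s _.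
rewrite mulrCA; congr (_ * _); rewrite [LHS](bigD1 i)//= [in RHS](bigD1 i)//= [RHS]mulrA.
congr (_ * _); last first.
  by apply: eq_bigr => k /negbTE ki; rewrite /upd ki.
by rewrite /upd eqxx; case: eqP => _; ring.
Qed.

Lemma gcoef_affine th i x S : gcoef (upd th i x) S =
  gcoef (upd th i 0) S - x * (gcoef (upd th i 0) S - gcoef (upd th i 1) S).
Proof.
rewrite /gcoef -sumrB mulr_sumr -sumrB; apply: eq_bigr => s _.
rewrite !(bigD1 i (P := xpredT))//=.
have E y : \prod_(k | k != i) (if k \in S then if s k == k then 1
      else upd th i y k * R (s k) k else (s k == k)%:R) =
   \prod_(k | k != i) (if k \in S then if s k == k then 1
      else th k * R (s k) k else (s k == k)%:R).
  by apply: eq_bigr => k /negbTE ki; rewrite /upd ki.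
rewrite (E x) (E 0) (E 1); move: (\prod_(k | k != i) _) ((-1) ^+ s) => P c.
by rewrite /upd eqxx; case: ifP => _; case: eqP => _; ring.
Qed.

Lemma gdet_coord th i p : gdet th (fun k => if k == i then p else 0) = 1 + p.
Proof.
rewrite /gdet (bigD1 1%g)//= odd_perm1 expr0 mul1r [X in _ + X]big1 ?addr0.
  rewrite (bigD1 i)//= perm1 !eqxx big1 ?mulr1// => k ki.
  by rewrite perm1 eqxx (negbTE ki) addr0.
move=> s s1; have [k ki sk] : exists2 k, k != i & s k != k.
  apply/exists_inP; apply: contraNT s1; rewrite negb_exists_in => /forall_inP h.
  apply/eqP/permP => k; rewrite perm1.
  have {}h l : l != i -> s l = l by move=> /h; rewrite negbK => /eqP.
  have [->|/h//] := eqVneq k i.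
  apply/eqP; apply/negPn/negP => si.
  by have /perm_inj/eqP := h _ si; rewrite (negbTE si).
by rewrite (bigD1 k)//= (negbTE sk) (negbTE ki) mul0r mulr0 mul0r mulr0.
Qed.

Lemma gdet_0 th : gdet th (fun=> 0) = 1.
Proof.
rewrite /gdet (bigD1 1%g)//= odd_perm1 expr0 mul1r [X in _ + X]big1 ?addr0.
  by apply: big1 => k _; rewrite perm1 eqxx.
move=> s s1; have [k sk] : exists k, s k != k.
  apply/existsP; apply: contraNT s1; rewrite negb_exists => /forallP h.
  by apply/eqP/permP => k; rewrite perm1; move: (h k); rewrite negbK => /eqP.
by rewrite (bigD1 k)//= (negbTE sk) mul0r mulr0 mul0r mulr0.
Qed.

End damped_determinant.

(** * Multivariate gamma distribution functions as limits *)

Section gamma_cdf_limits.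
Context {K : realType} {n : nat}.
Implicit Types (A : 'M[K]_n) (x t : 'rV[K]_n) (k : 'I_n -> nat).

Lemma is_laplace_transform_ext (mu : probability (n.-tuple K) K) (phi psi : 'rV[K]_n -> K) :
  (forall t, (forall j, 0 <= t 0 j) -> phi t = psi t) ->
  is_laplace_transform mu phi -> is_laplace_transform mu psi.
Proof. by move=> pp [m1 mphi]; split=> // t t0; rewrite mphi// pp. Qed.

Definition natdet A k : K := \det (1%:M + A *m diag_mx (\row_j (k j)%:R)).

Lemma law_natdet alpha A (mu : probability (n.-tuple K) K) :
  is_laplace_transform mu (gamma_lt alpha A) ->
  forall k, (\int[mu]_y (expR (- \sum_j (k j)%:R * tnth y j))%:E =
    (natdet A k `^ (- alpha))%:E)%E.
Proof.
move=> [_ h] k; rewrite -[RHS](h (\row_j (k j)%:R)); last by move=> j; rewrite mxE.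
by apply: eq_integral => y _; under [in RHS]eq_bigr do rewrite mxE.
Qed.

Let m_tnth (j : 'I_n) : measurable_fun [set: n.-tuple K] (fun y => tnth y j).
Proof. exact: measurable_tnth. Qed.

(** Infinite divisibility makes the defining set nonempty, so the default value 0 is not the one
    returned by fallback. Whichever law the choice selects has the prescribed transform, which is
    all that is used. *)
Lemma mgamma_cdfP alpha A x : 0 < alpha -> nonsingular_correlation_matrix A ->
  infinitely_divisible A -> exists2 mu : probability (n.-tuple K) K,
    is_laplace_transform mu (gamma_lt alpha A) &
    (mgamma_cdf alpha A x)%:E = mu [set y | forall j, tnth y j <= x 0 j].
Proof.
move=> a0 hA /(_ _ a0)[mu0 hmu0].
have [|mu [_ _ hmu] E] := @xgetPex _ 0 [set p | exists2 mu : probability (n.-tuple K) K,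
    is_gamma_distribution alpha A mu &
    p%:E = mu [set y | forall j, tnth y j <= x 0 j]].
  exists (fine (mu0 [set y | forall j, tnth y j <= x 0 j])); exists mu0 => //.
  rewrite fineK// fin_num_measure//.
  exact: (@measurable_lower_orthant _ _ _ _ (fun j y => tnth y j)).
by exists mu.
Qed.

Lemma mpos_natdet alpha A : 0 < alpha -> infinitely_divisible A ->
  mpos (fun k => natdet A k `^ (- alpha)).
Proof.
move=> a0 /(_ _ a0)[mu hmu].
apply: (@mpos_law _ _ _ _ mu (fun j y => tnth y j)) => //.
- exact: probability_setT.
- by case: hmu.
- exact: law_natdet.
Qed.

Lemma cvg_mgamma_cdf (m : nat -> nat) alpha A x :
  (forall N j, (size (test_poly (x 0%R j) N) <= m N)%N) ->
  0 < alpha -> nonsingular_correlation_matrix A ->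
  infinitely_divisible A -> (forall j, 0 < x 0 j) ->
  plam (m N) (fun j => test_poly (x 0 j) N)
    (fun k => natdet A k `^ (- alpha)) @[N --> \oo] --> mgamma_cdf alpha A x.
Proof.
move=> xm a0 hA iA x0; have [mu hmu E] := mgamma_cdfP x a0 hA iA.
apply: (@cvg_plam_law _ _ _ _ mu (fun j y => tnth y j)) => //.
- exact: probability_setT.
- by case: hmu.
- exact: law_natdet.
Qed.

End gamma_cdf_limits.

Section damped_family.
Context {K : realType} {n : nat}.
Variable R : 'M[K]_n.
Hypothesis hR : nonsingular_correlation_matrix R.
Implicit Types (tau t : 'rV[K]_n) (th : 'I_n -> K).

Let R1 i : R i i = 1. Proof. by case: hR => -[]. Qed.

Lemma damped_quad tau (u : 'cV[K]_n) :
  (u^T *m damped_mx R tau *m u) 0 0 = \sum_i (1 - tau 0 i ^+ 2) * u i 0 ^+ 2 +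
   ((\col_i (tau 0 i * u i 0))^T *m R *m \col_i (tau 0 i * u i 0)) 0 0.
Proof.
rewrite /damped_mx mulmxDr mulmxDl mxE; congr (_ + _).
  rewrite mul_mx_diag mxE; apply: eq_bigr => i _; rewrite !mxE; ring.
rewrite !mxE; apply: eq_bigr => j _; rewrite !mxE !mulr_suml; apply: eq_bigr => i _.
by rewrite !mxE; ring.
Qed.

(** The quadratic form splits into a nonnegative diagonal part and that of [R] at [tau_i u_i]. If
    both vanish, then [tau_i u_i = 0] by definiteness of [R], and the diagonal part leaves
    [u_i ^ 2 = 0]. *)
Lemma damped_correlation tau : (forall j, 0 <= tau 0 j <= 1) ->
  nonsingular_correlation_matrix (damped_mx R tau).
Proof.
case: hR => -[RT Rpsd _] Ru tau01.
have c0 i : 0 <= 1 - tau 0 i ^+ 2.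
  by rewrite subr_ge0; case/andP: (tau01 i) => ? ?; rewrite expr_le1.
have s0 (u : 'cV[K]_n) i : 0 <= (1 - tau 0 i ^+ 2) * u i 0 ^+ 2 by rewrite mulr_ge0 ?sqr_ge0.
split; first split.
- apply/matrixP => i j; rewrite !mxE (eq_sym j i).
  have -> : R j i = R i j by rewrite -[in LHS]RT mxE.
  by case: eqP => [->|_]; rewrite ?mulr1n ?mulr0n; ring.
- by move=> u; rewrite damped_quad addr_ge0// sumr_ge0.
- by move=> i; rewrite !mxE eqxx mulr1n R1; ring.
apply: unitmx_of_pd => u; rewrite damped_quad => /eqP.
rewrite paddr_eq0 ?sumr_ge0// => /andP[/eqP su /eqP/(pd_of_nonsingular RT Rpsd Ru) v0].
apply/matrixP => i j; rewrite (ord1 j) [RHS]mxE; apply/eqP; rewrite -sqrf_eq0.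
have /eqP : (1 - tau 0 i ^+ 2) * u i 0 ^+ 2 = 0.
  apply/eqP; move/eqP: su; rewrite psumr_eq0// => /allP/(_ i).
  by rewrite mem_index_enum => /(_ isT).
have : tau 0 i * u i 0 = 0 by have /matrixP/(_ i 0) := v0; rewrite !mxE.
rewrite mulrBl mul1r -exprMn => ->; rewrite expr0n/= subr0 => /eqP ->; exact: eqxx.
Qed.

Lemma gdet_gt0 th (t : 'I_n -> K) : (forall k, 0 <= th k <= 1) -> (forall k, 0 <= t k) ->
  0 < gdet R th t.
Proof.
move=> th01 t0; pose tau : 'rV[K]_n := \row_k Num.sqrt (th k).
have -> : gdet R th t = gdet R (fun k => tau 0 k ^+ 2) (fun k => (\row_j t j) 0 k : K).
  congr gdet; apply/funext => k; rewrite !mxE// sqr_sqrtr//; by case/andP: (th01 k).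
rewrite -gdetE//; apply: det_laplace_gt0; last by move=> j; rewrite mxE.
have tau01 j : 0 <= tau 0 j <= 1.
  rewrite mxE sqrtr_ge0/= -[leRHS]sqrtr1 ler_wsqrtr//; by case/andP: (th01 j).
by case: (damped_correlation tau01) => -[].
Qed.

Lemma gamma_ltE alpha tau t : gamma_lt alpha (damped_mx R tau) t =
  gdet R (fun k => tau 0 k ^+ 2) (fun k => t 0 k) `^ (- alpha).
Proof. by rewrite /gamma_lt gdetE. Qed.

Lemma damped_mx1 : damped_mx R (const_mx 1) = R.
Proof.
apply/matrixP => i j; rewrite !mxE expr1n subrr mul0rn add0r mul1r mulr1//.
Qed.

Lemma damped_infinitely_divisible tau : infinitely_divisible R ->
  (forall j, 0 <= tau 0 j <= 1) -> infinitely_divisible (damped_mx R tau).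
Proof.
move=> iR tau01 alpha a0.
(* Coordinates are damped one at a time; [s] lists those already treated, and the others keep the
   parameter 1 that [gdet_damp] requires. *)
pose th (s : seq 'I_n) k := if k \in s then tau 0 k ^+ 2 else 1.
have tau2 k : 0 <= tau 0 k ^+ 2 <= 1.
  by case/andP: (tau01 k) => ? ?; rewrite exprn_ge0// expr_le1.
have th01 s k : 0 <= th s k <= 1 by rewrite /th; case: ifP => _//; rewrite ler01 lexx.
suff /(_ (enum 'I_n) (enum_uniq _))[mu hmu] : forall s, uniq s ->
    exists mu : probability (n.-tuple K) K, is_laplace_transform mu
      (fun t : 'rV[K]_n => gdet R (th s) (fun k => t 0 k) `^ (- alpha)).
  exists mu; apply: is_laplace_transform_ext hmu => t _; rewrite gamma_ltE.
  by congr (gdet _ _ _ `^ _); apply/funext => k; rewrite /th mem_enum.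
elim=> [_|i s ih /= /andP[is_ us]].
  have [mu hmu] := iR _ a0; exists mu.
  apply: is_laplace_transform_ext hmu => t _; rewrite -{1}damped_mx1 gamma_ltE.
  by congr (gdet _ _ _ `^ _); apply/funext => k; rewrite /th in_nil mxE expr1n.
have [mu hmu] := ih us.
have thE : th (i :: s) = upd (th s) i (tau 0 i ^+ 2).
  by apply/funext => k; rewrite /upd /th in_cons; case: eqP => [->|].
have thi : th s i = 1 by rewrite /th (negbTE is_).
(* Parameter 1 leaves the law unchanged and is excluded from [laplace_damp], which divides by
   [1 - th]. *)
have [t1|t1] := leP 1 (tau 0 i ^+ 2).
  exists mu; apply: is_laplace_transform_ext hmu => t _; congr (gdet _ _ _ `^ _).
  have {}t1 : tau 0 i ^+ 2 = 1 by apply/eqP; rewrite eq_le t1 andbT; case/andP: (tau2 i).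
  by rewrite thE t1; apply/funext => k; rewrite /upd; case: eqP => [->|].
have h01 : 0 <= tau 0 i ^+ 2 < 1 by rewrite t1 andbT; case/andP: (tau2 i).
have [nu hnu] := laplace_damp (PosNum a0) i h01 hmu.
exists nu; apply: is_laplace_transform_ext hnu => t t0.
have d0 : 0 < 1 + (1 - tau 0 i ^+ 2) * t 0 i.
  by rewrite ltr_wpDr// mulr_ge0// subr_ge0 ltW.
rewrite thE (@gdet_damp _ _ R (th s) (fun k => t 0 k))//; last by rewrite gt_eqF.
rewrite powRM ?(ltW d0)//; last first.
  rewrite ltW// gdet_gt0// => k; rewrite /upd; case: eqP => _ //.
  by rewrite divr_ge0 ?(ltW d0)// mulr_ge0//; case/andP: h01.
congr (_ * (gdet _ _ _ `^ _)); apply/funext => k; by rewrite /upd mxE.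
Qed.

End damped_family.

(** * Dependence on one damping parameter *)

(** Only the identity and the transposition fix every point off the pair. This minor is the one
    whose strict dependence on [th i] is easy to exhibit. *)
Lemma gcoef_pair {K : realType} {n : nat} (R : 'M[K]_n) (th : 'I_n -> K) (i j : 'I_n) :
  i != j -> gcoef R th [set i; j]%SET = 1 - th i * th j * (R i j * R j i).
Proof.
move=> ij; have tij : tperm i j != 1%g.
  by apply: contraNneq ij => /permP/(_ i); rewrite tpermL perm1 => ->.
rewrite /gcoef (bigD1 1%g)//= (bigD1 (tperm i j))//= [X in _ + (_ + X)]big1 ?addr0.
  rewrite odd_perm1 odd_tperm ij/= expr0 expr1 mul1r big1 => [|k _]; last first.
    by rewrite perm1 eqxx; case: ifP.
  rewrite (bigD1 i)//= (bigD1 j)/=; last by rewrite eq_sym.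
  rewrite big1 => [|k /andP[/negbTE ki /negbTE kj]]; last first.
    by rewrite !inE ki kj/= tpermD ?eqxx// eq_sym ?ki ?kj.
  rewrite tpermL tpermR (negbTE ij) eq_sym (negbTE ij) !inE !eqxx orbT/=.
  move: (R i j) (R j i) (th i) (th j) => *; ring.
move=> s /andP[s1 st]; suff [k ks sk] : exists2 k, k \notin [set i; j]%SET & s k != k.
  by rewrite (bigD1 k)//= (negbTE ks) (negbTE sk) mul0r mulr0.
apply/exists_inP; apply: contraNT st; rewrite negb_exists_in => /forall_inP h.
have {}h l : l \notin [set i; j]%SET -> s l = l by move=> /h; rewrite negbK => /eqP.
have sS l : l \in [set i; j]%SET -> s l \in [set i; j]%SET.
  by move=> lS; apply/negPn/negP => sl; have e := perm_inj (h _ sl); move: sl; rewrite e lS.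
have si : s i = j.
  have := sS i; rewrite !inE eqxx => /(_ isT)/orP[/eqP si|/eqP//].
  case/eqP: s1; apply/permP => k; rewrite perm1.
  have [/h//|] := boolP (k \notin [set i; j]%SET); rewrite negbK !inE => /orP[]/eqP->//.
  have := sS j; rewrite !inE eqxx orbT => /(_ isT)/orP[/eqP sj|/eqP//].
  by move: ij; rewrite -(inj_eq (@perm_inj _ s)) si sj eqxx.
apply/eqP/permP => k; have [kS|] := boolP (k \notin [set i; j]%SET).
  by rewrite h// tpermD//; apply: contraNneq kS => ->; rewrite !inE eqxx ?orbT.
rewrite negbK !inE => /orP[]/eqP->; rewrite ?tpermL ?tpermR//.
have := sS j; rewrite !inE eqxx orbT => /(_ isT)/orP[/eqP//|/eqP sj].
by move: ij; rewrite -(inj_eq (@perm_inj _ s)) si sj eqxx.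
Qed.

Section coordinate_family.
Context {K : realType} {n : nat}.
Variable R : 'M[K]_n.
Hypothesis hR : nonsingular_correlation_matrix R.
Hypothesis iR : infinitely_divisible R.
Implicit Types (tau : 'rV[K]_n) (th : 'I_n -> K) (k : 'I_n -> nat).

Let R1 i : R i i = 1. Proof. by case: hR => -[]. Qed.

Lemma natdet_damped tau k :
  natdet (damped_mx R tau) k = manat (gcoef R (fun j => tau 0 j ^+ 2)) k.
Proof.
rewrite /natdet gdetE// gdet_mafun /manat; congr mafun.
by apply/funext => j; rewrite mxE.
Qed.

Section coefficients.
Variable th : 'I_n -> K.
Hypothesis th01 : forall j, 0 <= th j <= 1.
Local Notation d := (gcoef R th).
Let tau : 'rV[K]_n := \row_j Num.sqrt (th j).

Let tau01 j : 0 <= tau 0 j <= 1.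
Proof.
by rewrite mxE sqrtr_ge0/= -[leRHS]sqrtr1 ler_wsqrtr//; case/andP: (th01 j).
Qed.

Let tau2 : (fun j => tau 0 j ^+ 2) = th.
Proof. by apply/funext => k; rewrite mxE sqr_sqrtr//; case/andP: (th01 k). Qed.

Lemma manat_gcoef_gt0 k : 0 < manat d k.
Proof. by rewrite /manat -gdet_mafun// gdet_gt0. Qed.

Lemma mpos_manat_gcoef al : 0 < al -> mpos (fun k => manat d k `^ (- al)).
Proof.
move=> al0; have := mpos_natdet al0 (damped_infinitely_divisible hR iR tau01).
by under eq_fun do rewrite natdet_damped tau2.
Qed.

Lemma manat_gcoef0 : manat d (fun=> 0%N) = 1.
Proof. by rewrite /manat -gdet_mafun// gdet_0. Qed.

Lemma manat_gcoef1 j p : manat d (fun l => if l == j then p else 0%N) = 1 + p%:R.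
Proof.
rewrite /manat -gdet_mafun// -(gdet_coord R th j p%:R); congr gdet.
by apply/funext => l; case: eqP.
Qed.

Lemma gcoef_setT_gt0 : 0 < d [set: 'I_n]%SET.
Proof.
rewrite lt_def; apply/andP; split; last first.
  by apply: mafun_ge0_coef => k; exact/ltW/manat_gcoef_gt0.
rewrite -tau2 gcoef_setT//; have [_] := damped_correlation hR tau01.
by rewrite unitmxE unitfE.
Qed.

End coefficients.

Variables (th : 'I_n -> K) (i : 'I_n).
Hypothesis th01 : forall j, 0 <= th j <= 1.
Local Notation d x := (gcoef R (upd th i x)).
Local Notation b := (fun S => d 0 S - d 1 S).

Let upd01 (x : K) : 0 <= x <= 1 -> forall j, 0 <= upd th i x j <= 1.
Proof. by move=> x01 k; rewrite /upd; case: eqP. Qed.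

Let d01 := @upd01 0 (introT andP (conj (lexx _) ler01)).
Let d11 := @upd01 1 (introT andP (conj ler01 (lexx _))).

Let dE x : (fun S => d 0 S - x * b S) = d x.
Proof. by apply/funext => S; rewrite -gcoef_affine. Qed.

(** At [th i = 0] the determinant is [1 + k_i] times its value for [k_i = 0], so [manat_le] at
    [th i = 1] says that [manat b] is nonnegative at integer points; its coefficients inherit
    this. *)
Lemma gcoef_slope_ge0 S : 0 <= b S.
Proof.
move: S; apply: (@mafun_ge0_coef _ _ b) => k.
have -> : manat b k = manat (d 0) k - manat (d 1) k.
  by rewrite /manat /mafun -sumrB; apply: eq_bigr => S _; rewrite mulrBl.
rewrite subr_ge0; apply: le_trans
  (manat_le (manat_gcoef_gt0 d11) (mpos_manat_gcoef d11) (manat_gcoef0 _) (manat_gcoef1 _) i k) _.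
rewrite /manat -!gdet_mafun//.
have -> : upd th i 0 = upd (upd th i 1) i 0 by apply/funext => l; rewrite /upd; case: eqP.
rewrite gdet_upd0// (_ : (fun j => _) = upd (fun j => (k j)%:R) i 0)//.
by apply/funext => l; rewrite /upd; case: eqP.
Qed.

Section increments.
Variables (al : K) (q : 'I_n -> {poly K}) (m : nat).
Hypothesis al0 : 0 < al.
Hypothesis qm : forall j, (size (q j) <= m)%N.
Hypothesis qt : forall j, decreasing_test (q j).
Local Notation D x := (fun k => manat (d x) k).

Lemma plam_family_increment (c s t : K) : 0 <= s -> s < t -> t <= 1 ->
  (forall x, s < x < t ->
    c <= \sum_S b S * plam m (Xderiv_on S q) (fun k => D x k `^ (- (al + 1)))) ->
  al * c * (t - s) <= plam m q (fun k => D t k `^ (- al)) - plam m q (fun k => D s k `^ (- al)).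
Proof.
move=> s0 st t1 h; rewrite -(dE s) -(dE t).
apply: plam_increment => //.
  by move=> x k x01; rewrite dE; apply: manat_gcoef_gt0; exact: upd01.
by move=> x xst; rewrite dE; exact: h.
Qed.

Let term_ge0 (x : K) (S : {set 'I_n}) : 0 <= x <= 1 ->
  0 <= b S * plam m (Xderiv_on S q) (fun k => D x k `^ (- (al + 1))).
Proof.
move=> x01; rewrite mulr_ge0 ?gcoef_slope_ge0// plam_ge0//.
- by apply: mpos_manat_gcoef; [exact: upd01|rewrite addr_gt0].
- exact: size_Xderiv_on.
- exact: Xderiv_on_ge0.
Qed.

Lemma plam_family_le (s t : K) : 0 <= s -> s < t -> t <= 1 ->
  plam m q (fun k => D s k `^ (- al)) <= plam m q (fun k => D t k `^ (- al)).
Proof.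
move=> s0 st t1; rewrite -subr_ge0.
have := @plam_family_increment 0 s t s0 st t1; rewrite mulr0 mul0r; apply.
move=> x /andP[sx xt]; apply: sumr_ge0 => S _; apply: term_ge0.
by rewrite (le_trans s0 (ltW sx)) (le_trans (ltW xt) t1).
Qed.

(** All terms of the derivative are nonnegative, so only [J] is kept; there [mpos_lower_bound]
    splits the functional into one-dimensional sums. *)
Lemma plam_family_lower (J : {set 'I_n}) (x : K) (kappa : 'I_n -> K) : 0 <= x <= 1 ->
  (forall j, 0 < kappa j) ->
  (forall j, kappa j <= \sum_(l < m) (if j \in J then 'X * (q j)^`() else q j)`_l *
     (d x [set~ j]%SET + d x [set: 'I_n]%SET * l%:R) `^ (- (al + 1))) ->
  b J * (d 1 [set: 'I_n]%SET `^ ((al + 1) * (n%:R - 1)) * \prod_j kappa j) <=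
  \sum_S b S * plam m (Xderiv_on S q) (fun k => D x k `^ (- (al + 1))).
Proof.
move=> x01 k0 hk; have x01' := upd01 x01.
rewrite [leRHS](bigD1 J)//=.
apply: le_trans (_ : _ <= b J * plam m (Xderiv_on J q) (fun k => D x k `^ (- (al + 1)))) _;
  last by rewrite lerDl sumr_ge0// => S _; exact: term_ge0.
rewrite ler_wpM2l ?gcoef_slope_ge0//.
have be0 : 0 < al + 1 by rewrite addr_gt0.
have dT := gcoef_setT_gt0 x01'.
have hm : forall be j, 0 < be ->
    mpos (fun k : 'I_n -> nat => hfac (d x) j (k j) `^ (- be)).
  move=> be j be'; apply: mpos_gamma_coord => //.
  have := hfac_gt0 (manat_gcoef_gt0 x01') (mpos_manat_gcoef x01') (manat_gcoef0 _)
      (manat_gcoef1 _) dT j 0.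
    by rewrite /hfac mulr0 addr0.
have lb := mpos_lower_bound (manat_gcoef_gt0 x01') (mpos_manat_gcoef x01') (manat_gcoef0 _)
  (manat_gcoef1 _) dT hm be0.
apply: le_trans (plam_le lb (size_Xderiv_on J qm) (Xderiv_on_ge0 J qt)).
rewrite plamZ (@plam_prod _ _ _ _ (fun j p => hfac (d x) j p `^ (- (al + 1)))).
apply: ler_pM.
- exact: powR_ge0.
- by apply: prodr_ge0 => j _; exact: ltW.
(* The index [i] shows [n >= 1], so the exponent is nonnegative; the top coefficient decreases in
   [x], hence is smallest at 1. *)
- have n1 : 1 <= n%:R :> K by rewrite ler1n; case: (n) i => // -[].
  rewrite ge0_ler_powR//.
  + by rewrite mulr_ge0 ?(ltW be0)// subr_ge0.
  + by rewrite nnegrE ltW// gcoef_setT_gt0.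
  + by rewrite nnegrE ltW.
  rewrite (gcoef_affine R th i x); have := gcoef_slope_ge0 [set: 'I_n]%SET.
  by case/andP: x01; nra.
by apply: ler_prod => j _; rewrite (ltW (k0 j))//= /Xderiv_on; exact: hk.
Qed.

End increments.

(** The coefficients decrease along the family, so on all of [0, 1] they lie between their values at
    1 and at 0. These are the ranges for [gamma_test_lower], which makes the gap independent of
    [N]. *)
Lemma plam_family_gap al (m : nat -> nat) (x : 'I_n -> K) (J : {set 'I_n}) (s t : K) :
  (forall N j, (size (test_poly (x j) N) <= m N)%N) -> 0 < al -> (forall j, 0 < x j) ->
  0 < b J -> 0 <= s -> s < t -> t <= 1 ->
  exists2 c, 0 < c & \forall N \near \oo,
    c <= plam (m N) (fun j => test_poly (x j) N)
           (fun k => manat (d t) k `^ (- al)) -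
         plam (m N) (fun j => test_poly (x j) N)
           (fun k => manat (d s) k `^ (- al)).
Proof.
move=> xm al0 x0 bJ s0 st t1.
have be1 : 1 <= al + 1 by rewrite lerDr ltW.
pose P j kap := 0 < kap /\ \forall N \near \oo, forall h0 h1 (bb : bool) m,
    0 < h0 <= d 0 [set~ j]%SET -> d 1 [set: 'I_n]%SET <= h1 <= d 0 [set: 'I_n]%SET ->
    (size (test_poly (x j) N) <= m)%N ->
    kap <= \sum_(l < m) (if bb then 'X * (test_poly (x j) N)^`() else test_poly (x j) N)`_l *
      (h0 + h1 * l%:R) `^ (- (al + 1)).
have /choice[kap kapP] : forall j, exists kap, P j kap.
  move=> j; have [kap k0 hk] := gamma_test_lower (d 0 [set~ j]%SET) (x0 j) be1
    (gcoef_setT_gt0 d11) (gcoef_setT_gt0 d01).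
  by exists kap.
pose C := b J * (d 1 [set: 'I_n]%SET `^ ((al + 1) * (n%:R - 1)) * \prod_j kap j).
have C0 : 0 < C.
  rewrite mulr_gt0// mulr_gt0 ?powR_gt0 ?gcoef_setT_gt0//.
  by apply: prodr_gt0 => j _; case: (kapP j).
exists (al * C * (t - s)); first by rewrite mulr_gt0 ?subr_gt0// mulr_gt0.
have : \forall N \near \oo, forall j, forall h0 h1 (bb : bool) m,
    0 < h0 <= d 0 [set~ j]%SET -> d 1 [set: 'I_n]%SET <= h1 <= d 0 [set: 'I_n]%SET ->
    (size (test_poly (x j) N) <= m)%N ->
    kap j <= \sum_(l < m) (if bb then 'X * (test_poly (x j) N)^`() else test_poly (x j) N)`_l *
      (h0 + h1 * l%:R) `^ (- (al + 1)).
  by apply: filter_forall => j; case: (kapP j).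
apply: filterS => N hN.
have qt j : decreasing_test (test_poly (x j) N) by exact: decreasing_test_poly.
apply: plam_family_increment => // y /andP[sy yt].
have y01 : 0 <= y <= 1 by rewrite (le_trans s0 (ltW sy)) (le_trans (ltW yt) t1).
have y01' := upd01 y01; apply: plam_family_lower => // j; first by case: (kapP j).
have dT := gcoef_setT_gt0 y01'.
apply: hN => //.
  apply/andP; split.
    have := hfac_gt0 (manat_gcoef_gt0 y01') (mpos_manat_gcoef y01') (manat_gcoef0 _)
      (manat_gcoef1 _) dT j 0.
    by rewrite /hfac mulr0 addr0.
  by rewrite (gcoef_affine R th i y) gerBl mulr_ge0 ?gcoef_slope_ge0//; case/andP: y01.
rewrite (gcoef_affine R th i y); have := gcoef_slope_ge0 [set: 'I_n]%SET.
by case/andP: y01; nra.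
Qed.

End coordinate_family.

(** * Distribution functions *)

Section damped_monotonicity.
Context {K : realType} {n : nat}.
Variable R : 'M[K]_n.
Hypothesis hR : nonsingular_correlation_matrix R.
Hypothesis iR : infinitely_divisible R.
Implicit Types (sigma tau : 'rV[K]_n).
Variables (alpha : K) (x : 'rV[K]_n).
Hypothesis alpha0 : 0 < alpha.
Hypothesis x0 : forall j, 0 < x 0 j.

Let unit01 tau := forall j, 0 <= tau 0 j <= 1.
Let m N := (\max_j size (test_poly (x 0%R j) N))%N.
Let q N (j : 'I_n) := test_poly (x 0%R j) N.

Let size_q N j : (size (q N j) <= m N)%N.
Proof. exact: (leq_bigmax j). Qed.

Let cvg_damped tau : unit01 tau ->
  plam (m N) (q N) (fun k => manat (gcoef R (fun j => tau 0 j ^+ 2)) k `^ (- alpha))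
    @[N --> \oo] --> mgamma_cdf alpha (damped_mx R tau) x.
Proof.
move=> tau01;
rewrite (_ : (fun k => _) = fun k => natdet (damped_mx R tau) k `^ (- alpha)); last first.
  by apply/funext => k; rewrite natdet_damped.
exact: (cvg_mgamma_cdf size_q alpha0 (damped_correlation hR tau01)
  (damped_infinitely_divisible hR iR tau01) x0).
Qed.

Let upd_sqr sigma tau i : (forall j, j != i -> sigma 0 j = tau 0 j) ->
  (fun j => sigma 0 j ^+ 2) = upd (fun j => tau 0 j ^+ 2) i (sigma 0 i ^+ 2).
Proof.
by move=> st; apply/funext => j; rewrite /upd; case: eqP => [->|/eqP/st ->].
Qed.

Let sqr01 tau : unit01 tau -> forall j, 0 <= tau 0 j ^+ 2 <= 1.
Proof. by move=> t01 j; case/andP: (t01 j) => ? ?; rewrite exprn_ge0//= expr_le1. Qed.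

Lemma mgamma_damped_le i sigma tau : unit01 sigma -> unit01 tau ->
  (forall j, j != i -> sigma 0 j = tau 0 j) -> sigma 0 i <= tau 0 i ->
  mgamma_cdf alpha (damped_mx R sigma) x <= mgamma_cdf alpha (damped_mx R tau) x.
Proof.
move=> s01 t01 st; rewrite le_eqVlt => /predU1P[sti|sti].
  rewrite (_ : sigma = tau)//; apply/rowP => j.
  by have [->|/st] := eqVneq j i.
apply: (cvg_le_lim (cvg_damped s01) (cvg_damped t01)) => N.
rewrite (upd_sqr (i := i) (fun j _ => erefl (tau 0 j))) (upd_sqr st).
have /andP[s0 _] := s01 i; have /andP[t0 t1] := sqr01 t01 i.
apply: plam_family_le => //; first exact: sqr01.
- by move=> j; exact: decreasing_test_poly.
- by rewrite exprn_ge0.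
- by rewrite ltr_pXn2r// nnegrE// ltW// (le_lt_trans s0).
Qed.

Lemma mgamma_damped_lt i j sigma tau : unit01 sigma -> unit01 tau ->
  (forall j, j != i -> sigma 0 j = tau 0 j) -> sigma 0 i < tau 0 i ->
  i != j -> tau 0 j * R i j != 0 ->
  mgamma_cdf alpha (damped_mx R sigma) x < mgamma_cdf alpha (damped_mx R tau) x.
Proof.
move=> s01 t01 st sti ij Rij; pose th k := tau 0 k ^+ 2.
have RT : R j i = R i j by case: hR => -[+ _ _] _ => RT; rewrite -[in LHS]RT mxE.
(* The slope of the minor on {i, j} is [(tau 0 j * R i j) ^+ 2]. *)
have bJ : 0 < gcoef R (upd th i 0) [set i; j]%SET - gcoef R (upd th i 1) [set i; j]%SET.
  rewrite !gcoef_pair// /upd eqxx eq_sym (negbTE ij) !mul0r subr0 mul1r RT.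
  rewrite subKr /th -expr2 -exprMn.
  by rewrite lt_def sqr_ge0 sqrf_eq0 Rij.
have /andP[s0 _] := s01 i; have /andP[t0 t1] := sqr01 t01 i.
have th01 : forall k, 0 <= th k <= 1 by exact: sqr01.
have [|||c c0 hc] := @plam_family_gap _ _ R hR iR th i th01 alpha m (fun j => x 0 j)
  [set i; j]%SET (sigma 0 i ^+ 2) (tau 0 i ^+ 2) size_q alpha0 x0 bJ.
- by rewrite exprn_ge0.
- by rewrite ltr_pXn2r// nnegrE// ltW// (le_lt_trans s0).
- exact: t1.
rewrite -subr_gt0; apply: lt_le_trans c0 _.
apply: (cvgr_to_ge (cvgB (cvg_damped t01) (cvg_damped s01))).
apply: filterS hc => N.
by rewrite (upd_sqr (i := i) (fun j _ => erefl (tau 0 j))) (upd_sqr st).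
Qed.

Lemma mgamma_damped_mono sigma tau : unit01 sigma -> unit01 tau ->
  (forall j, sigma 0 j <= tau 0 j) ->
  mgamma_cdf alpha (damped_mx R sigma) x <= mgamma_cdf alpha (damped_mx R tau) x.
Proof.
move=> s01 t01 st.
(* Interpolation between [sigma] and [tau] that raises one coordinate at a time. *)
pose rho (s : seq 'I_n) : 'rV[K]_n := \row_k (if k \in s then tau 0 k else sigma 0 k).
have rho01 s : unit01 (rho s) by move=> j; rewrite mxE; case: ifP.
have -> : tau = rho (enum 'I_n) by apply/rowP => j; rewrite mxE mem_enum.
elim: (enum 'I_n) => [|i s ih].
  by rewrite (_ : rho [::] = sigma)//; apply/rowP => j; rewrite mxE.
apply: le_trans ih _; apply: (@mgamma_damped_le i) => //.
  by move=> j /negbTE ji; rewrite !mxE in_cons ji.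
by rewrite !mxE in_cons eqxx/=; case: ifP.
Qed.

End damped_monotonicity.

Lemma damped_mxE {K : realType} {n : nat} (R : 'M[K]_n) (tau : 'rV[K]_n) i j :
  damped_mx R tau i j =
  (1 - tau 0 i ^+ 2) *+ (i == j) + tau 0 i * R i j * tau 0 j.
Proof. by rewrite !mxE. Qed.

(** * Block matrices, marginals and independence *)

Section block_matrices.
Context {K : realType} {m : nat}.
Variables (R11 : 'M[K]_m) (r : 'cV[K]_m).
Local Notation R := (block_mx R11 r r^T 1%:M : 'M[K]_(m + 1)).

(** Scaling [r] by [c] is damping of the last coordinate alone, since its diagonal entry is
    [1 - c ^ 2 + c ^ 2]. *)
Lemma damped_block (c : K) : (forall i, R11 i i = 1) ->
  block_mx R11 (c *: r) (c *: r^T) 1%:M =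
  damped_mx R (row_mx (const_mx 1) (const_mx c)) :> 'M[K]_(m + 1).
Proof.
move=> R1; apply/matrixP => i j; rewrite damped_mxE.
rewrite -(fintype.splitK i) -(fintype.splitK j).
case: (fintype.split i) => i'; case: (fintype.split j) => j' /=.
- by rewrite !(block_mxEul, row_mxEl, mxE) expr1n subrr mul0rn add0r mul1r mulr1.
- by rewrite eq_lrshift !(block_mxEur, row_mxEl, row_mxEr, mxE) mulr0n add0r mul1r mulrC.
- by rewrite eq_rlshift !(block_mxEdl, row_mxEl, row_mxEr, mxE) mulr0n add0r mulr1.
- rewrite (ord1 i') (ord1 j') !(block_mxEdr, row_mxEr, mxE) !eqxx !mulr1n; ring.
Qed.

Lemma ulblock_correlation : nonsingular_correlation_matrix R ->
  nonsingular_correlation_matrix R11.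
Proof.
move=> [[RT Rpsd R1] Ru].
have E (u : 'cV[K]_m) :
    (u^T *m R11 *m u) 0 0 = ((col_mx u 0 : 'cV_(m + 1))^T *m R *m col_mx u 0) 0 0.
  rewrite tr_col_mx trmx0 mul_row_block mul_row_col !mul0mx !addr0 mulmx0 addr0 //.
have sym : R11^T = R11.
  by move: RT; rewrite tr_block_mx => /eq_block_mx[].
split; first split => //.
- by move=> u; rewrite E.
- by move=> i; have := R1 (lshift 1 i); rewrite block_mxEul.
apply: unitmx_of_pd => u; rewrite E => /(pd_of_nonsingular RT Rpsd Ru) /matrixP u0.
by apply/matrixP => i j; have := u0 (lshift 1 i) j; rewrite col_mxEu !mxE => ->.
Qed.

(** Either alternative kills the upper right block. [S = 0] is the independent case, and [a = 0]
    reads off the marginal of the first [m] coordinates. *)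
Lemma det_block0 (S : 'cV[K]_m) (S' : 'rV[K]_m) (t : 'rV[K]_m) (a : K) :
  S = 0 \/ a = 0 ->
  \det (1%:M + block_mx R11 S S' 1%:M *m diag_mx (row_mx t (const_mx a) : 'rV_(m + 1))) =
  \det (1%:M + R11 *m diag_mx t) * (1 + a).
Proof.
move=> Sa; rewrite diag_mx_row mulmx_block !mulmx0 !addr0 !add0r mul1mx.
rewrite (_ : S *m _ = 0); last first.
  case: Sa => ->; first by rewrite mul0mx.
  by rewrite (_ : const_mx 0 = 0)// linear0 mulmx0.
rewrite scalar_mx_block add_block_mx !addr0 add0r det_lblock; congr (_ * _).
by rewrite det_mx11 !mxE eqxx !mulr1n.
Qed.

Lemma ulblock_infinitely_divisible : infinitely_divisible R -> infinitely_divisible R11.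
Proof.
move=> iR alpha a0; have [mu [mu1 muL]] := iR _ a0.
pose ul (y : (m + 1).-tuple K) : m.-tuple K := [tuple tnth y (lshift 1 j) | j < m].
have mul : measurable_fun [set: (m + 1).-tuple K] ul.
  apply/measurable_fun_tnthP => j.
  under [X in measurable_fun _ X]eq_fun do rewrite /= tnth_mktuple.
  exact: measurable_tnth.
have mpre A : measurable A -> measurable (ul @^-1` A).
  by move=> mA; rewrite -[X in measurable X]setTI; exact: (mul measurableT _ mA).
pose nu : giry (m.-tuple K) K := giry_map mul (mu : giry _ K).
have nuT : nu [set: m.-tuple K] = 1%E.
  by rewrite -[LHS]/(mu (ul @^-1` setT)) preimage_setT probability_setT.
exists (unit_mass_prob nuT : probability _ K); split.
  rewrite -[LHS]/(mu (ul @^-1` _)); have mo := @measurable_orthant K.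
  apply/eqP; rewrite eq_le probability_le1/=; last by apply: mpre; exact: mo.
  rewrite -mu1; apply: le_measure.
  - by apply: mem_set; exact: mo.
  - by apply: mem_set; apply: mpre; exact: mo.
  - by move=> y /= y0 j; rewrite tnth_mktuple.
move=> t t0; rewrite -[LHS]/(\int[nu]_y _)%E -[LHS]/(giry_int _ _) giry_int_map//; last first.
  exact: measurable_laplace.
rewrite /giry_int.
have t0' : forall j, 0 <= (row_mx t (const_mx 0) : 'rV_(m + 1)) 0 j.
  by move=> j; rewrite mxE; case: fintype.split => l; rewrite ?mxE.
rewrite /gamma_lt -[X in (X `^ _)%:E]mulr1 -[in X in _ * X](addr0 1).
rewrite -(det_block0 (S := r) r^T t (or_intror erefl)) -[RHS](muL _ t0').
apply: eq_integral => y _ /=; congr (expR (- _))%:E.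
rewrite big_split_ord/= big_ord1 row_mxEr mxE mul0r addr0.
by apply: eq_bigr => j _; rewrite row_mxEl tnth_mktuple.
Qed.

End block_matrices.

Lemma cvg_gamma_cdf {K : realType} (alpha x : K) (m : nat -> nat) : 0 < alpha -> 0 < x ->
  (forall N, (size (test_poly x N) <= m N)%N) ->
  \sum_(i < m N) (test_poly x N)`_i * (1 + i%:R) `^ (- alpha) @[N --> \oo] -->
    gamma_cdf alpha x.
Proof.
move=> a0 x0 xm.
have := @cvg_plam_law K 1 _ K (gamma_law alpha) (fun _ => id)
  (fun k => \prod_j (1 + (k j)%:R) `^ (- alpha)) (gamma_lawT a0) _ _ _ m (fun=> x)
  (gamma_cdf alpha x) (fun N _ => xm N) (fun=> x0).
rewrite (_ : (fun N => plam _ _ _) = fun N =>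
    \sum_(i < m N) (test_poly x N)`_i * (1 + i%:R) `^ (- alpha)).
  apply.
  - by move=> j; exact: measurable_id.
  - rewrite (_ : mkset _ = [set y | 0 <= y]); first exact: gamma_law_ge0_set.
    by apply/seteqP; split => y /=; [apply; exact: ord0|].
  - move=> k; rewrite big_ord1 -laplace_gamma_law//.
    by apply: eq_integral => y _; rewrite big_ord1.
  - rewrite -gamma_law_cdf//; congr gamma_law.
    by apply/seteqP; split => y /=; [|apply; exact: ord0].
by apply/funext => N; rewrite (@plam_prod _ _ _ _ (fun _ i => (1 + i%:R) `^ (- alpha))) big_ord1.
Qed.

Lemma plam_split {K : realType} {m : nat} d (q : 'I_(m + 1) -> {poly K})
    (f : ('I_m -> nat) -> K) (g : nat -> K) :
  plam d q (fun k => f (fun j => k (lshift 1 j)) * g (k (rshift m 0))) =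
  plam d (fun j => q (lshift 1 j)) f * \sum_(i < d) (q (rshift m 0))`_i * g i.
Proof.
pose h (p : {ffun 'I_m -> 'I_d} * 'I_d) : {ffun 'I_(m + 1) -> 'I_d} :=
  [ffun j => match fintype.split j with inl l => p.1 l | inr _ => p.2 end].
have hl p l : h p (lshift 1 l) = p.1 l.
  by rewrite ffunE -[lshift 1 l]/(unsplit (inl l)) unsplitK.
have hr p : h p (rshift m 0) = p.2.
  by rewrite ffunE -[rshift m 0]/(unsplit (inr 0)) unsplitK.
rewrite /plam mulr_suml; under [RHS]eq_bigr do rewrite mulr_sumr.
rewrite pair_bigA/= (reindex h); last first.
  exists (fun k : {ffun 'I_(m + 1) -> 'I_d} => ([ffun l => k (lshift 1 l)], k (rshift m 0))).
    by move=> [a b] _ /=; rewrite hr; congr pair; apply/ffunP => l; rewrite ffunE hl.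
  move=> k _; apply/ffunP => j; rewrite -(fintype.splitK j).
  by case: (fintype.split j) => l /=; [rewrite hl ffunE|rewrite (ord1 l) hr].
apply: eq_bigr => p _; rewrite big_split_ord/= big_ord1 hr.
rewrite [f _](_ : _ = f (fun j => p.1 j)); last by congr f; apply/funext => j; rewrite hl.
under eq_bigr do rewrite hl; ring.
Qed.

Section independent_blocks.
Context {K : realType} {m : nat}.
Variable R11 : 'M[K]_m.
Local Notation R0 := (block_mx R11 0 0 1%:M : 'M[K]_(m + 1)).

(** The determinant factorises at every integer point, hence so do the test integrals, and their
    limits multiply; no product law has to be constructed. *)
Lemma mgamma_cdf_block0 alpha (x : 'rV[K]_(m + 1)) : 0 < alpha -> (forall j, 0 < x 0 j) ->
  nonsingular_correlation_matrix R11 -> infinitely_divisible R11 ->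
  nonsingular_correlation_matrix R0 -> infinitely_divisible R0 ->
  mgamma_cdf alpha R0 x =
  mgamma_cdf alpha R11 (lsubmx x) * gamma_cdf alpha (x 0 (rshift m 0)).
Proof.
move=> a0 x0 h1 i1 h0 i0.
pose D N := (\max_j size (test_poly (x 0%R j) N))%N.
have xD N j : (size (test_poly (x 0%R j) N) <= D N)%N by exact: (leq_bigmax j).
have x1 j : 0 < lsubmx x 0 j by rewrite mxE.
have x1D N j : (size (test_poly (lsubmx x 0%R j) N) <= D N)%N by rewrite mxE.
have c1 := cvg_mgamma_cdf x1D a0 h1 i1 x1.
have c2 := cvg_gamma_cdf a0 (x0 (rshift m 0)) (fun N => xD N _).
have c0 := cvg_mgamma_cdf xD a0 h0 i0 x0.
rewrite -(cvg_lim (@norm_hausdorff _ _) c0); apply: cvg_lim; first exact: norm_hausdorff.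
rewrite (_ : (fun N => plam (D N) _ _) = fun N => plam (D N) (fun j => test_poly (lsubmx x 0 j) N)
  (fun k => natdet R11 k `^ (- alpha)) *
  \sum_(i < D N) (test_poly (x 0 (rshift m 0)) N)`_i * (1 + i%:R) `^ (- alpha));
  first exact: cvgM c1 c2.
apply/funext => N.
have -> : (fun j => test_poly (lsubmx x 0 j) N) = (fun j => test_poly (x 0 (lshift 1 j)) N).
  by apply/funext => j; rewrite mxE.
rewrite -[RHS](plam_split (D N) (fun j => test_poly (x 0 j) N)
  (fun k => natdet R11 k `^ (- alpha)) (fun i => (1 + i%:R) `^ (- alpha))).
congr plam; apply/funext => k.
rewrite -powRM.
- congr (_ `^ _); rewrite /natdet -(det_block0 _ (S := 0) 0 _ (or_introl erefl)).
  congr (\det (_ + _ *m diag_mx _)); apply/rowP => j; rewrite mxE -(fintype.splitK j).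
  by case: (fintype.split j) => l /=; rewrite ?row_mxEl ?row_mxEr mxE// (ord1 l).
- by apply/ltW/det_laplace_gt0; [case: h1 => -[]|move=> j; rewrite mxE].
- by rewrite addr_ge0.
Qed.

End independent_blocks.

Lemma prod_powR {K : realType} (I : Type) (s : seq I) (f : I -> K) (a : K) :
  (forall i, 0 <= f i) -> (\prod_(i <- s) f i) `^ a = \prod_(i <- s) f i `^ a.
Proof.
move=> f0; elim: s => [|i s ih]; first by rewrite !big_nil powR1.
by rewrite !big_cons powRM ?ih// prodr_ge0.
Qed.

Lemma mgamma_cdf_id {K : realType} {n : nat} alpha (x : 'rV[K]_n) : 0 < alpha ->
  (forall j, 0 < x 0 j) -> nonsingular_correlation_matrix (1%:M : 'M[K]_n) ->
  infinitely_divisible (1%:M : 'M[K]_n) ->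
  mgamma_cdf alpha 1%:M x = \prod_j gamma_cdf alpha (x 0 j).
Proof.
move=> a0 x0 h1 i1.
pose D N := (\max_j size (test_poly (x 0%R j) N))%N.
have xD N j : (size (test_poly (x 0%R j) N) <= D N)%N by exact: (leq_bigmax j).
have c1 := cvg_mgamma_cdf xD a0 h1 i1 x0.
have c2 : \prod_j (\sum_(i < D N) (test_poly (x 0 j) N)`_i * (1 + i%:R) `^ (- alpha))
    @[N --> \oo] --> \prod_j gamma_cdf alpha (x 0 j).
  by apply: cvg_prodr => j _; apply: cvg_gamma_cdf => // N; exact: xD.
rewrite -(cvg_lim (@norm_hausdorff _ _) c1); apply: cvg_lim; first exact: norm_hausdorff.
rewrite (_ : (fun N => plam (D N) _ _) = fun N =>
  \prod_j (\sum_(i < D N) (test_poly (x 0 j) N)`_i * (1 + i%:R) `^ (- alpha))) //.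
apply/funext => N; rewrite -(@plam_prod _ _ _ _ (fun=> fun i => (1 + i%:R) `^ (- alpha))).
congr plam; apply/funext => k.
rewrite /natdet mul1mx -diag_const_mx -linearD det_diag.
under eq_bigr do rewrite !mxE.
by rewrite prod_powR// => j; rewrite addr_ge0.
Qed.

Theorem theorem2 (K : realType) (m : nat) (R11 : 'M[K]_m) (r : 'cV[K]_m) :
  let R : 'M[K]_(m + 1) := block_mx R11 r r^T 1%:M in
  let Rt (tau : K) : 'M[K]_(m + 1) :=
    block_mx R11 (tau *: r) (tau *: r^T) 1%:M in
  (2 <= m + 1)%N ->
  nonsingular_correlation_matrix R ->
  r != 0 ->
  infinitely_divisible R ->
  [/\ forall tau : K, 0 <= tau <= 1 ->
        nonsingular_correlation_matrix (Rt tau) /\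
        infinitely_divisible (Rt tau),
      forall (alpha : K) (x : 'rV[K]_(m + 1)),
        0 < alpha -> (forall j, 0 < x 0 j) ->
        forall s t : K, 0 <= s <= 1 -> 0 <= t <= 1 -> s < t ->
          mgamma_cdf alpha (Rt s) x < mgamma_cdf alpha (Rt t) x
    & forall (alpha : K) (x : 'rV[K]_(m + 1)),
        0 < alpha -> (forall j, 0 < x 0 j) ->
        mgamma_cdf alpha R11 (lsubmx x) * gamma_cdf alpha (x 0 (rshift m 0))
          < mgamma_cdf alpha R x
        /\
        \prod_(j < m + 1) gamma_cdf alpha (x 0 j)
          <= mgamma_cdf alpha R11 (lsubmx x) * gamma_cdf alpha (x 0 (rshift m 0))]
  /\
  ((forall tau : 'rV[K]_(m + 1), (forall j, 0 <= tau 0 j <= 1) ->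
      nonsingular_correlation_matrix (damped_mx R tau) /\
      infinitely_divisible (damped_mx R tau)) /\
   (forall (alpha : K) (x : 'rV[K]_(m + 1)),
      0 < alpha -> (forall j, 0 < x 0 j) ->
      forall (i : 'I_(m + 1)) (sigma tau : 'rV[K]_(m + 1)),
        (forall j, 0 <= sigma 0 j <= 1) ->
        (forall j, 0 <= tau 0 j <= 1) ->
        (forall j, j != i -> sigma 0 j = tau 0 j) ->
        sigma 0 i <= tau 0 i ->
        mgamma_cdf alpha (damped_mx R sigma) x
          <= mgamma_cdf alpha (damped_mx R tau) x)).
Proof.
move=> R Rt _ hR r0 iR.
have h11 : nonsingular_correlation_matrix R11 by exact: ulblock_correlation hR.
have R1 i : R11 i i = 1 by case: h11 => -[].
pose last_damped c : 'rV[K]_(m + 1) := row_mx (const_mx 1) (const_mx c).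
have last_lshift c j : last_damped c 0 (lshift 1 j) = 1 by rewrite row_mxEl mxE.
have last_rshift c : last_damped c 0 (rshift m 0) = c by rewrite row_mxEr mxE.
have last_eq c c' j : j != rshift m 0 -> last_damped c 0 j = last_damped c' 0 j.
  rewrite -(fintype.splitK j); case: (fintype.split j) => l /=.
    by rewrite !last_lshift.
  by rewrite (ord1 l) eqxx.
have RtE c : Rt c = damped_mx R (last_damped c) by exact: damped_block.
have last01 c : 0 <= c <= 1 -> forall j, 0 <= last_damped c 0 j <= 1.
  move=> c01 j; rewrite -(fintype.splitK j); case: (fintype.split j) => l /=.
    by rewrite last_lshift ler01 lexx.
  by rewrite (ord1 l) last_rshift.
have i11 : infinitely_divisible R11 by exact: ulblock_infinitely_divisible iR.
have Rt1 : Rt 1 = R by rewrite /Rt !scale1r.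
have Rt0 : Rt 0 = block_mx R11 0 0 1%:M by rewrite /Rt !scale0r.
have c0 : 0 <= (0 : K) <= 1 by rewrite lexx ler01.
have c1 : 0 <= (1 : K) <= 1 by rewrite lexx ler01.
have hRt c : 0 <= c <= 1 -> nonsingular_correlation_matrix (Rt c) /\ infinitely_divisible (Rt c).
  move=> c01; rewrite RtE; split; first by apply: damped_correlation => //; exact: last01.
  by apply: damped_infinitely_divisible => //; exact: last01.
have lt_Rt alpha (x : 'rV[K]_(m + 1)) : 0 < alpha -> (forall j, 0 < x 0 j) ->
    forall s t : K, 0 <= s <= 1 -> 0 <= t <= 1 -> s < t ->
      mgamma_cdf alpha (Rt s) x < mgamma_cdf alpha (Rt t) x.
  move=> a0 x0 s t s01 t01 st; have /cV0Pn[j rj] := r0; rewrite !RtE.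
  apply: (@mgamma_damped_lt _ _ R hR iR alpha x a0 x0 (rshift m 0) (lshift 1 j)).
  - exact: last01.
  - exact: last01.
  - by move=> l; exact: last_eq.
  - by rewrite !last_rshift.
  - by rewrite eq_rlshift.
  - by rewrite last_lshift mul1r block_mxEdl mxE.
have factor alpha (x : 'rV[K]_(m + 1)) : 0 < alpha -> (forall j, 0 < x 0 j) ->
    mgamma_cdf alpha R11 (lsubmx x) * gamma_cdf alpha (x 0 (rshift m 0)) =
    mgamma_cdf alpha (Rt 0) x.
  move=> a0 x0; have := hRt 0 c0; rewrite Rt0 => -[h0 i0].
  exact/esym/(mgamma_cdf_block0 a0 x0 h11 i11 h0 i0).
split; last first.
  split=> [tau t01|alpha x a0 x0 i sigma tau s01 t01 st sti].
    by split; [exact: damped_correlation|exact: damped_infinitely_divisible].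
  exact: (@mgamma_damped_le _ _ R hR iR alpha x a0 x0 i sigma tau).
split=> // alpha x a0 x0; rewrite factor//; split; first by rewrite -[in ltRHS]Rt1 lt_Rt.
have z01 j : 0 <= (0 : 'rV[K]_(m + 1)) 0 j <= 1 by rewrite mxE.
(* Total damping is full independence: the product of the univariate functions belongs to the zero
   vector, and raising the first [m] coordinates to 1 reaches [Rt 0]. *)
have d0 : damped_mx R 0 = 1%:M.
  by apply/matrixP => i j; rewrite !mxE expr0n subr0 mulr0 addr0.
have h1 := damped_correlation hR z01; have i1 := damped_infinitely_divisible hR iR z01.
rewrite d0 in h1 i1; rewrite -(mgamma_cdf_id a0 x0 h1 i1) -d0 RtE.
apply: (mgamma_damped_mono hR iR a0 x0 z01 (last01 0 c0)) => j.
by rewrite mxE; case/andP: (last01 0 c0 j).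
Qed.
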